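(* There exist constants $C_0,c_1>0$ and absolute constants $0<c\le C<\infty$ such that the following holds. Suppose $n\ge2$, $0<q<1$ and $\pi\sim\mu_{n,q}$. (i) $c\,b_{n,q}\le \mathbb{E}(\mathrm{LDS}(\pi))\le C\,b_{n,q}$, where $$b_{n,q}=\begin{cases}\dfrac{1}{\sqrt{1-q}} & \text{if } 1-\frac{C_0}{(\log n)^2}\le q\le 1-\frac4n,\\[1em] \dfrac{\log n}{\log((1-q)(\log n)^2)} & \text{if } 1-\frac{c_1(\log\log n)^2}{\log n}\le q\le 1-\frac{C_0}{(\log n)^2},\\[1em] \sqrt{\dfrac{\log n}{\log(1/q)}} & \text{if } \frac1n\le q\le 1-\frac{c_1(\log\log n)^2}{\log n}.\end{cases}$$ (ii) If $0<q\le \frac1n$ then $c\,nq\le \mathbb{E}(\mathrm{LDS}(\pi))-1\le C\,nq$.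
   Context: For $q>0$ and an integer $n\ge1$, the Mallows measure $\mu_{n,q}$ on $S_n$ is $\mu_{n,q}(\pi)=q^{\mathrm{inv}(\pi)}/Z_{n,q}$, where $\mathrm{inv}(\pi)$ is the number of pairs $i<j$ with $\pi(i)>\pi(j)$ and $Z_{n,q}$ is the normalizing constant. $\mathrm{LDS}(\pi)$ denotes the length of a longest decreasing subsequence of $\pi$, i.e. the maximal $m$ with indices $i_1<\dots<i_m$ such that $\pi(i_1)>\dots>\pi(i_m)$. *)

(* Defs.v *)
From mathcomp Require Import all_boot all_order all_algebra all_fingroup.
From mathcomp Require Import Rstruct.
From Stdlib Require Import Rdefinitions.
Set Implicit Arguments. Unset Strict Implicit. Unset Printing Implicit Defensive.
Import GRing.Theory.

Definition inv_count (n : nat) (s : 'S_n) : nat :=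
  #|[set ij : 'I_n * 'I_n | (ij.1 < ij.2)%N && (s ij.2 < s ij.1)%N]|.

Definition decr_on (n : nat) (s : 'S_n) (A : {set 'I_n}) : bool :=
  [forall i in A, forall j in A, (i < j)%N ==> (s j < s i)%N].

Definition LDS (n : nat) (s : 'S_n) : nat :=
  \max_(A : {set 'I_n} | decr_on s A) #|A|.

Local Open Scope ring_scope.

Definition mallows_Z (n : nat) (q : R) : R :=
  \sum_(s : 'S_n) q ^+ inv_count s.

Definition mallows (n : nat) (q : R) (s : 'S_n) : R :=
  q ^+ inv_count s / mallows_Z n q.

Definition E_LDS (n : nat) (q : R) : R :=
  \sum_(s : 'S_n) mallows q s * (LDS s)%:R.

(* Main.v *)
(* Build a Mallows permutation by appending entries: the entry appended to a
   permutation of size t has exactly d - 1 larger predecessors with probability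
   proportional to q^(d-1), 1 <= d <= t+1, independently of the past.  If the
   last entry of a decreasing subsequence has l - 1 larger entries, the new
   entry extends the subsequence (whose level l becomes d) when d > l, and
   otherwise just raises the level to l + 1.

   Upper bounds.  The expected number of decreasing (j+1)-subsequences is at most
   n phi_j(0) for every family phi with phi_0 >= 1 that is superharmonic for
   this level process; the normalising factor 1 - q^(t+1) cancels, so phi need
   not depend on t.  Two explicit families are used.  The first one,
   q^(j(j+1)/2 + ja) / (1-q)^(2j), settles the third regime and (ii).  The second
   one comes from the WKB ansatz theta^(2j) / (2j)!, where theta is the tangent of
   half the angle whose sine is q^(a/2); its value n (32/(1-q))^j / ((2j)! sqrt(1-q))
   settles the first two regimes.

   Lower bounds.  Cut the entries into windows of length w and pick greedily, in
   each window, at most one entry with d in (l, l+w].  In k windows the level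
   stays below 2kw, so each window succeeds with probability at least
   1 - (1 - q^(2kw) (1 - q^w))^w.  Linearity of expectation gives the first
   regime; the other two follow by waiting, among many disjoint blocks, for a
   block in which all k windows succeed. *)

From Stdlib Require Import Reals Factorial Lra Lia Psatz ZArith.
Local Open Scope R_scope.

(** * Superharmonic families *)

Lemma exp_le_compat x y : x <= y -> exp x <= exp y.
Proof. intros [H| ->]; [left; apply exp_increasing, H|right; reflexivity]. Qed.

Lemma exp_pow n x : exp x ^ n = exp (INR n * x).
Proof.
induction n as [|n IHn].
- simpl; rewrite Rmult_0_l, exp_0; reflexivity.
- rewrite S_INR; simpl; rewrite IHn, <- exp_plus; f_equal; ring.
Qed.

(** * The geometric family *)

Section GeoFamily.
Variable q : R.
Hypothesis q01 : 0 < q < 1.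

Fixpoint geo_phi (j a : nat) : R :=
  match j with
  | O => 1
  | S j' => geo_phi j' a * (q ^ (S j' + a) / (1 - q) ^ 2)
  end.

Lemma geo_phi_succ j a :
  geo_phi (S j) a = geo_phi j a * (q ^ (S j + a) / (1 - q) ^ 2).
Proof. reflexivity. Qed.

(** As [geo_phi j] is geometric in [a] with ratio [q ^ j], this is the exact tail sum of
    [q ^ c * geo_phi j c] over [c > a]: the unnormalised gain from all jumps out of level
    [a + 1]. *)
Definition geo_flux (j a : nat) : R :=
  q ^ (S a) * geo_phi j (S a) / (1 - q ^ (S j)).

Lemma pow_01 n : 0 < q ^ n <= 1.
Proof.
split; [apply pow_lt; lra|].
rewrite <- (pow1 n); apply pow_incr; lra.
Qed.

Lemma one_minus_powS n : 1 - q <= 1 - q ^ (S n).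
Proof. simpl; pose proof (pow_01 n); nra. Qed.

Lemma geo_phi_pos j a : 0 < geo_phi j a.
Proof.
induction j as [|j IH]; [simpl; lra|rewrite geo_phi_succ].
apply Rmult_lt_0_compat; [exact IH|].
apply Rdiv_lt_0_compat; [apply pow_01|apply pow_lt; lra].
Qed.

Lemma geo_phi_S j a : geo_phi j (S a) = q ^ j * geo_phi j a.
Proof.
induction j as [|j IH]; [simpl; lra|rewrite !geo_phi_succ].
rewrite IH, Nat.add_succ_r; simpl; unfold Rdiv; ring.
Qed.

Lemma geo_phi_decr j a : geo_phi j (S a) <= geo_phi j a.
Proof.
rewrite geo_phi_S; pose proof (pow_01 j); pose proof (geo_phi_pos j a); nra.
Qed.

Lemma geo_flux_ge0 j a : 0 <= geo_flux j a.
Proof.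
pose proof (one_minus_powS j).
apply Rlt_le, Rdiv_lt_0_compat; [|lra].
apply Rmult_lt_0_compat; [apply pow_01|apply geo_phi_pos].
Qed.

Lemma geo_phi_geo_flux j c : q ^ (S c) * geo_phi j (S c) <= geo_flux j c - geo_flux j (S c).
Proof.
pose proof (one_minus_powS j).
apply Req_le; unfold geo_flux; rewrite (geo_phi_S j (S c)).
change (q ^ S (S c)) with (q * q ^ S c).
change (q ^ S j) with (q * q ^ j) in *.
field; lra.
Qed.

(** Superharmonicity: the gain from jumps is paid for by the loss when an entry with [d <= a + 1]
    raises the level. Up to a common factor the claim is [(1 - q) / u <= v * u / (1 - q) ^ 2], and
    [u], [v] are at least [1 - q]. *)
Lemma geo_flux_geo_phi j a : (1 - q) * geo_flux j a <=
  (1 - q ^ (S a)) * (geo_phi (S j) a - geo_phi (S j) (S a)).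
Proof.
pose proof (one_minus_powS j) as Hj; pose proof (one_minus_powS a) as Ha.
rewrite (geo_phi_S (S j)); rewrite geo_phi_succ; unfold geo_flux; rewrite geo_phi_S.
replace (q ^ (S j + a)) with (q ^ S a * q ^ j)
  by (rewrite <- pow_add; f_equal; lia).
pose proof (pow_01 (S a)); pose proof (pow_01 j); pose proof (geo_phi_pos j a).
set (X := q ^ S a * q ^ j * geo_phi j a).
assert (HX : 0 < X) by (apply Rmult_lt_0_compat; [apply Rmult_lt_0_compat|]; lra).
set (u := 1 - q ^ S j) in *; set (v := 1 - q ^ S a) in *.
replace ((1 - q) * (q ^ S a * (q ^ j * geo_phi j a) / u))
  with (X * ((1 - q) / u)) by (unfold X, Rdiv; ring).
replace (v * (geo_phi j a * (q ^ S a * q ^ j / (1 - q) ^ 2) -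
   q ^ S j * (geo_phi j a * (q ^ S a * q ^ j / (1 - q) ^ 2))))
  with (X * (v * u / (1 - q) ^ 2)) by (unfold X, u, Rdiv; ring).
apply Rmult_le_compat_l; [lra|].
apply Rle_trans with 1.
- apply Rmult_le_reg_r with u; [lra|]; unfold Rdiv; rewrite Rmult_assoc, Rinv_l; lra.
- apply Rmult_le_reg_r with ((1 - q) ^ 2); [apply pow_lt; lra|].
  unfold Rdiv; rewrite Rmult_assoc, Rinv_l; [simpl; nra|].
  apply pow_nonzero; lra.
Qed.

Lemma geo_phi_exp j l m : q = exp (- l) -> 1 - q = exp (- m) -> 0 <= l ->
  geo_phi j 0 <= exp (2 * INR j * m - INR j * INR j * l / 2).
Proof.
intros Hl Hm l0; induction j as [|j IH].
- simpl; replace (_ - _) with 0 by lra; rewrite exp_0; lra.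
- rewrite geo_phi_succ, Nat.add_0_r.
  assert (Hp : q ^ S j / (1 - q) ^ 2 = exp (2 * m - INR (S j) * l)).
  { rewrite Hm, Hl; unfold Rdiv.
    rewrite !exp_pow, <- exp_Ropp, <- exp_plus; f_equal; simpl (INR 2); ring. }
  rewrite Hp.
  apply Rle_trans with (exp (2 * INR j * m - INR j * INR j * l / 2) *
    exp (2 * m - INR (S j) * l)).
  + apply Rmult_le_compat_r; [left; apply exp_pos|exact IH].
  + rewrite <- exp_plus, S_INR.
    apply exp_le_compat; nra.
Qed.

End GeoFamily.

(** * Power differences and the tangent of half an angle *)

Lemma pow_sub_ge p x y g : 0 <= y <= x -> 0 <= g -> g * g <= x * y ->
  INR (S p) * (x - y) * g ^ p <= x ^ S p - y ^ S p.
Proof.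
intros Hxy Hg Hgm.
(* AM-GM gives [2 * g ^ k <= x ^ k + y ^ k]. The recursion [E] below raises the exponent by two, so
   the induction carries two consecutive exponents. *)
assert (main : INR (S p) * (x - y) * g ^ p <= x ^ S p - y ^ S p /\
   INR (S (S p)) * (x - y) * g ^ S p <= x ^ S (S p) - y ^ S (S p)); [|tauto].
induction p as [|p [IH1 IH2]].
- simpl; split; [lra|].
  assert (2 * g <= x + y) by (apply Rsqr_incr_0; unfold Rsqr; nra).
  nra.
- split; [exact IH2|].
  assert (Hsum : 2 * g ^ S (S p) <= x ^ S (S p) + y ^ S (S p)).
  { assert (H0 : (g ^ S (S p)) * (g ^ S (S p)) <= x ^ S (S p) * y ^ S (S p)).
    { rewrite <- !Rpow_mult_distr; apply pow_incr; split; [nra|lra]. }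
    assert (0 <= g ^ S (S p)) by (apply pow_le; lra).
    assert (0 <= x ^ S (S p)) by (apply pow_le; lra).
    assert (0 <= y ^ S (S p)) by (apply pow_le; lra).
    set (u := x ^ S (S p)) in *; set (v := y ^ S (S p)) in *.
    set (w := g ^ S (S p)) in *.
    assert ((2 * w) * (2 * w) <= (u + v) * (u + v))
      by (pose proof (Rle_0_sqr (u - v)) as Hs; unfold Rsqr in Hs; lra).
    apply Rsqr_incr_0; unfold Rsqr; lra. }
  assert (E : x ^ S (S (S p)) - y ^ S (S (S p)) =
    (x - y) * (x ^ S (S p) + y ^ S (S p)) + x * y * (x ^ S p - y ^ S p))
    by (simpl; ring).
  rewrite E.
  assert (0 <= g ^ p) by (apply pow_le; lra).
  assert (0 <= INR (S p)) by apply pos_INR.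
  assert (A1 : (x - y) * (2 * g ^ S (S p)) <= (x - y) * (x ^ S (S p) + y ^ S (S p)))
    by (apply Rmult_le_compat_l; lra).
  assert (A2 : g * g * (INR (S p) * (x - y) * g ^ p) <= x * y * (x ^ S p - y ^ S p)).
  { apply Rmult_le_compat; try nra.
    apply Rmult_le_pos; [|lra]; apply Rmult_le_pos; lra. }
  rewrite (S_INR (S (S p))), (S_INR (S p)).
  change (g ^ S (S p)) with (g * (g * g ^ p)) in *.
  set (N := INR (S p)) in *; set (U := x ^ S (S p)) in *; set (V := y ^ S (S p)) in *.
  set (U' := x ^ S p) in *; set (V' := y ^ S p) in *; set (G := g ^ p) in *.
  lra.
Qed.

(** This is [tan (arcsin w / 2)]. *)
Definition half_tan (w : R) : R := w / (1 + sqrt (1 - w * w)).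

Lemma half_tan_ge0 w : 0 <= w -> 0 <= half_tan w.
Proof.
intros; unfold half_tan; pose proof (sqrt_pos (1 - w * w)).
apply Rmult_le_pos; [lra|left; apply Rinv_0_lt_compat; lra].
Qed.

(** Convexity of [ln half_tan] in [ln w]. It reduces to [(1 + s1) * (1 + s2) <= (1 + s) * (1 + s)],
    which follows from [s1 * s2 <= s * s] and [s1 + s2 <= 2 * s]. *)
Lemma half_tan_logconvex w w1 w2 : 0 < w1 <= 1 -> 0 < w2 <= 1 -> 0 < w ->
  w * w = w1 * w2 -> half_tan w * half_tan w <= half_tan w1 * half_tan w2.
Proof.
intros H1 H2 Hw E; unfold half_tan; rewrite E.
assert (B1 : 0 <= 1 - w1 * w1) by nra.
assert (B2 : 0 <= 1 - w2 * w2) by nra.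
assert (B : 0 <= 1 - w1 * w2) by nra.
pose proof (sqrt_pos (1 - w1 * w1)); pose proof (sqrt_pos (1 - w2 * w2)).
pose proof (sqrt_pos (1 - w1 * w2)).
pose proof (sqrt_sqrt _ B1); pose proof (sqrt_sqrt _ B2); pose proof (sqrt_sqrt _ B).
set (s1 := sqrt (1 - w1 * w1)) in *; set (s2 := sqrt (1 - w2 * w2)) in *.
set (s := sqrt (1 - w1 * w2)) in *.
assert (P : s1 * s2 <= s * s).
{ apply Rsqr_incr_0; unfold Rsqr; [|nra|nra].
  replace (s1 * s2 * (s1 * s2)) with ((s1 * s1) * (s2 * s2)) by ring.
  rewrite H4, H5, H6; pose proof (Rle_0_sqr (w1 - w2)) as Hs; unfold Rsqr in Hs; lra. }
assert (S : s1 + s2 <= 2 * s).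
{ apply Rsqr_incr_0; unfold Rsqr; [|lra|lra].
  pose proof (Rle_0_sqr (w1 - w2)) as Hs; pose proof (Rle_0_sqr (s1 - s2)) as Hs'.
  unfold Rsqr in Hs, Hs'; lra. }
replace (w / (1 + s) * (w / (1 + s))) with (w1 * w2 * / ((1 + s) * (1 + s)))
  by (rewrite <- E; field; lra).
replace (w1 / (1 + s1) * (w2 / (1 + s2))) with (w1 * w2 * / ((1 + s1) * (1 + s2)))
  by (field; lra).
apply Rmult_le_compat_l; [nra|]; apply Rinv_le_contravar; nra.
Qed.

(** With [s = sqrt (1 - w * w)], the derivative of [half_tan] is [1 / (s * (1 + s)) >= 1 / (2 * s)]
    and increases with [w]; this is the finite-difference form, taken at the left end [w']. *)
Lemma half_tan_sub w w' : 0 < w' <= w -> w <= 1 -> w' < 1 ->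
  (w - w') / (2 * sqrt (1 - w' * w')) <= half_tan w - half_tan w'.
Proof.
intros H1 H2 H3; unfold half_tan.
assert (B : 0 <= 1 - w * w) by nra.
assert (B' : 0 < 1 - w' * w') by nra.
pose proof (sqrt_pos (1 - w * w)); pose proof (sqrt_lt_R0 _ B').
pose proof (sqrt_sqrt _ B) as E; pose proof (sqrt_sqrt _ (Rlt_le _ _ B')) as E'.
set (s := sqrt (1 - w * w)) in *; set (s' := sqrt (1 - w' * w')) in *.
assert (ss : s <= s') by (apply Rsqr_incr_0; unfold Rsqr; nra).
assert (s1 : s <= 1) by (apply Rsqr_incr_0; unfold Rsqr; nra).
assert (s'1 : s' <= 1) by (apply Rsqr_incr_0; unfold Rsqr; nra).
(* [w * s' - w' * s] is the sine of the difference of the two angles. *)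
assert (D : 0 <= w * s' - w' * s - (w - w') / s').
{ assert (F : (s' - s) * (s' + s) = (w - w') * (w + w')) by nra.
  assert (G : (w - w') * w' <= (s' - s) * s').
  { assert ((w - w') * (2 * w') <= (s' - s) * (2 * s')) by nra. lra. }
  replace (w * s' - w' * s - (w - w') / s') with
    ((w' * ((s' - s) * s') - (w - w') * (1 - s' * s')) / s') by (field; lra).
  rewrite E'. apply Rmult_le_pos; [nra|left; apply Rinv_0_lt_compat; lra]. }
replace (w / (1 + s) - w' / (1 + s')) with
  (((w - w') + (w * s' - w' * s)) / ((1 + s) * (1 + s'))) by (field; lra).
apply Rle_trans with (((w - w') + (w - w') / s') / ((1 + s) * (1 + s'))).
- replace (((w - w') + (w - w') / s') / ((1 + s) * (1 + s'))) with
    ((w - w') / (s' * (1 + s))) by (field; lra).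
  apply Rmult_le_compat_l; [lra|]; apply Rinv_le_contravar; nra.
- apply Rmult_le_compat_r; [left; apply Rinv_0_lt_compat; nra|lra].
Qed.

(** * The trigonometric family *)

Section AngleFamily.
Variable q : R.
Hypothesis q01 : 0 < q < 1.

Let e := 1 - q.
Let h := sqrt q.
Let r := sqrt h.

(** Indices count half steps: [2 * a] belongs to the sine [q ^ (a / 2)] and [2 * a + 1] to the
    midpoint of [a] and [a + 1]. Potentials use even indices and fluxes odd ones, so that
    log-convexity makes the middle value a valid [g] in [pow_sub_ge]. *)
Definition theta (i : nat) : R := half_tan (sqrt (sqrt q) ^ i).
(** The cosine at [a + 1], the far end of the step that starts at [a]; unlike the cosine at [a], it
    does not vanish for [a = 0]. *)
Definition root_gap (a : nat) : R := sqrt (1 - q ^ S a).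

(** The divisor [root_gap a] is the WKB amplitude. The constant is [32 = 4 * 4 * 2]: the [4] of
    [angle_flux], the [4] of [theta_sub_even] and the ratio [2] of [root_gap_incr]. *)
Definition angle_phi (j a : nat) : R :=
  (32 / (1 - q)) ^ j * theta (2 * a) ^ (2 * j) /
  (INR (fact (2 * j)) * root_gap a).

Definition angle_flux (j a : nat) : R :=
  (32 / (1 - q)) ^ j * (4 / (1 - q)) * sqrt q ^ S a * theta (2 * a + 1) ^ (2 * j + 1) /
  INR (fact (2 * j + 1)).

Lemma sqrt_q_01 : 0 < h < 1 /\ h * h = q.
Proof.
unfold h; split; [|apply sqrt_sqrt; lra].
split; [apply sqrt_lt_R0; lra|]; rewrite <- sqrt_1; apply sqrt_lt_1; lra.
Qed.

Lemma sqrt_sqrt_q_01 : 0 < r < 1 /\ r * r = h.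
Proof.
destruct sqrt_q_01 as [H _]; unfold r; split; [|apply sqrt_sqrt; lra].
split; [apply sqrt_lt_R0; lra|]; rewrite <- sqrt_1; apply sqrt_lt_1; lra.
Qed.

Lemma pow_range x n : 0 < x < 1 -> 0 < x ^ n <= 1.
Proof.
intros; split; [apply pow_lt; lra|]; rewrite <- (pow1 n); apply pow_incr; lra.
Qed.

Lemma pow_rr n : r ^ (2 * n) = h ^ n.
Proof. rewrite pow_mult; simpl (r ^ 2); rewrite Rmult_1_r, (proj2 sqrt_sqrt_q_01); reflexivity. Qed.

Lemma pow_hh n : h ^ n * h ^ n = q ^ n.
Proof. rewrite <- Rpow_mult_distr, (proj2 sqrt_q_01); reflexivity. Qed.

Lemma root_gap_pos a : 0 < root_gap a <= 1.
Proof.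
unfold root_gap; pose proof (pow_range q (S a) q01); pose proof (one_minus_powS q q01 a).
split; [apply sqrt_lt_R0; lra|].
apply Rle_trans with (sqrt 1); [apply sqrt_le_1; lra|rewrite sqrt_1; lra].
Qed.

Lemma root_gap_sqr a : root_gap a * root_gap a = 1 - q ^ S a.
Proof. pose proof (one_minus_powS q q01 a); unfold root_gap; apply sqrt_sqrt; lra. Qed.

Lemma root_gap_incr a : root_gap a <= root_gap (S a) <= 2 * root_gap a.
Proof.
pose proof (root_gap_pos a); pose proof (root_gap_pos (S a)).
pose proof (root_gap_sqr a); pose proof (root_gap_sqr (S a)).
pose proof (pow_range q (S a) q01); pose proof (one_minus_powS q q01 a).
change (q ^ S (S a)) with (q * q ^ S a) in *; set (Q := q ^ S a) in *.
split; apply Rsqr_incr_0; unfold Rsqr; try lra; nra.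
Qed.

Lemma theta_ge0 i : 0 <= theta i.
Proof. apply half_tan_ge0; left; apply (pow_range r), sqrt_sqrt_q_01. Qed.

Lemma theta_logconvex i : theta (S i) * theta (S i) <= theta i * theta (S (S i)).
Proof.
pose proof (proj1 sqrt_sqrt_q_01).
unfold theta; fold h; fold r; apply half_tan_logconvex;
  try (apply pow_range; assumption); simpl; ring.
Qed.

Lemma theta_decr i : theta (S i) <= theta i.
Proof.
pose proof (proj1 sqrt_sqrt_q_01) as H.
pose proof (pow_range r i H); pose proof (pow_range r (S i) H).
assert (L : r ^ S i <= r ^ i) by (simpl; nra).
assert (L1 : r ^ S i < 1) by (simpl; nra).
pose proof (half_tan_sub (r ^ i) (r ^ S i) ltac:(lra) ltac:(lra) L1) as D.
assert (0 <= (r ^ i - r ^ S i) / (2 * sqrt (1 - r ^ S i * r ^ S i))).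
{ apply Rmult_le_pos; [lra|]; left; apply Rinv_0_lt_compat.
  apply Rmult_lt_0_compat; [lra|]; apply sqrt_lt_R0; nra. }
unfold theta; fold h; fold r; lra.
Qed.

Lemma theta_0 : theta 0 = 1.
Proof.
unfold theta, half_tan; simpl.
replace (1 - 1 * 1) with 0 by ring; rewrite sqrt_0; field.
Qed.

Lemma theta_sub_even a :
  h ^ a * e / (4 * root_gap a) <= theta (2 * a) - theta (2 * (S a)).
Proof.
pose proof sqrt_q_01 as [H E].
unfold theta; fold h; fold r; rewrite !pow_rr.
pose proof (pow_range h a H); pose proof (pow_range h (S a) H).
pose proof (root_gap_pos a).
assert (L : h ^ S a <= h ^ a) by (simpl; nra).
assert (L1 : h ^ S a < 1) by (simpl; nra).
eapply Rle_trans; [|apply half_tan_sub; lra].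
rewrite pow_hh; fold (root_gap a).
replace (h ^ a * e / (4 * root_gap a)) with (h ^ a * (e / 2) / (2 * root_gap a))
  by (field; lra).
apply Rmult_le_compat_r; [left; apply Rinv_0_lt_compat; lra|].
(* Since [1 - q = (1 - h) * (1 + h)]. *)
assert ((1 - q) / 2 <= 1 - h) by nra.
unfold e; simpl; nra.
Qed.

Lemma theta_sub_odd c :
  h ^ S c * e / (4 * root_gap (S c)) <= theta (2 * c + 1) - theta (2 * S c + 1).
Proof.
pose proof sqrt_q_01 as [H E]; pose proof sqrt_sqrt_q_01 as [H' E'].
unfold theta; fold h; fold r.
pose proof (root_gap_pos (S c)).
set (w := r ^ (2 * c + 1)); set (w' := r ^ (2 * S c + 1)).
assert (Ew : w = h ^ c * r) by (unfold w; rewrite pow_add, pow_rr; simpl; ring).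
assert (Ew' : w' = h ^ c * h * r)
  by (unfold w'; rewrite pow_add, pow_rr; simpl; ring).
pose proof (pow_range h c H).
assert (0 < h ^ c * r) by nra.
assert (L : 0 < w' <= w) by (rewrite Ew, Ew'; split; nra).
assert (W : w < 1) by (rewrite Ew; nra).
eapply Rle_trans; [|apply half_tan_sub; lra].
(* The cosine at the midpoint [c + 3/2] is at most the cosine at [c + 2]. *)
assert (G : sqrt (1 - w' * w') <= root_gap (S c)).
{ unfold root_gap; apply sqrt_le_1; try nra.
  - pose proof (one_minus_powS q q01 (S c)); lra.
  - assert (q ^ S (S c) <= w' * w'); [|lra].
    rewrite Ew'; rewrite <- pow_hh; simpl.
    assert (h * h <= h * r) by nra.
    assert (h ^ c * (h * h) <= h ^ c * (h * r)) by (apply Rmult_le_compat_l; lra).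
    assert (0 <= h ^ c * (h * h)) by nra. nra. }
assert (0 < sqrt (1 - w' * w')) by (apply sqrt_lt_R0; nra).
apply Rle_trans with ((w - w') / (2 * root_gap (S c))).
- replace (h ^ S c * e / (4 * root_gap (S c))) with
    (h ^ S c * (e / 2) / (2 * root_gap (S c))) by (field; lra).
  apply Rmult_le_compat_r; [left; apply Rinv_0_lt_compat; lra|].
  rewrite Ew, Ew'; unfold e; simpl.
  assert (h ^ c * h <= h ^ c * r) by nra.
  assert ((1 - q) / 2 <= 1 - h) by nra.
  nra.
- apply Rmult_le_compat_l; [lra|]; apply Rinv_le_contravar; lra.
Qed.

Lemma fact_pos n : 0 < INR (fact n).
Proof. apply INR_fact_lt_0. Qed.

Lemma K_pos j : 0 < (32 / (1 - q)) ^ j.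
Proof. apply pow_lt, Rdiv_lt_0_compat; lra. Qed.

Lemma angle_phi0_ge1 a : 1 <= angle_phi 0 a.
Proof.
unfold angle_phi; simpl; pose proof (root_gap_pos a).
replace (1 * 1 / (1 * root_gap a)) with (/ root_gap a) by (field; lra).
rewrite <- Rinv_1; apply Rinv_le_contravar; lra.
Qed.

Lemma angle_phi_ge0 j a : 0 <= angle_phi j a.
Proof.
unfold angle_phi; pose proof (root_gap_pos a); pose proof (K_pos j).
pose proof (fact_pos (2 * j)).
assert (0 <= theta (2 * a) ^ (2 * j)) by (apply pow_le, theta_ge0).
apply Rmult_le_pos; [nra|]; left; apply Rinv_0_lt_compat; nra.
Qed.

Lemma theta_even_decr a : theta (2 * S a) <= theta (2 * a).
Proof.
replace (2 * S a)%nat with (S (S (2 * a))) by lia.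
eapply Rle_trans; apply theta_decr.
Qed.

Lemma angle_phi_decr j a : angle_phi j (S a) <= angle_phi j a.
Proof.
unfold angle_phi; pose proof (root_gap_pos a); pose proof (root_gap_pos (S a)).
pose proof (root_gap_incr a); pose proof (K_pos j); pose proof (fact_pos (2 * j)).
assert (0 <= theta (2 * S a) ^ (2 * j)) by (apply pow_le, theta_ge0).
apply Rmult_le_compat.
- nra.
- left; apply Rinv_0_lt_compat; nra.
- apply Rmult_le_compat_l; [lra|]; apply pow_incr; split;
    [apply theta_ge0|apply theta_even_decr].
- apply Rinv_le_contravar; nra.
Qed.

Lemma angle_flux_ge0 j a : 0 <= angle_flux j a.
Proof.
unfold angle_flux; pose proof (K_pos j); pose proof (fact_pos (2 * j + 1)).
assert (0 <= theta (2 * a + 1) ^ (2 * j + 1)) by (apply pow_le, theta_ge0).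
pose proof (pow_range h (S a) (proj1 sqrt_q_01)).
assert (0 < 4 / (1 - q)) by (apply Rdiv_lt_0_compat; lra).
apply Rmult_le_pos; [|left; apply Rinv_0_lt_compat; lra].
apply Rmult_le_pos; [|lra]; fold h.
apply Rmult_le_pos; [apply Rmult_le_pos|]; lra.
Qed.

Lemma fact_odd j : INR (fact (2 * j + 1)) = INR (2 * j + 1) * INR (fact (2 * j)).
Proof. rewrite <- mult_INR; f_equal; rewrite Nat.add_1_r; reflexivity. Qed.

(** By [pow_sub_ge] and [theta_sub_odd], one step of [theta ^ (2 * j + 1)] releases
    [theta (2 * S c) ^ (2 * j)] times a multiple of [h ^ S c / root_gap (S c)]; the prefactor
    [h ^ S c] of the flux completes this to [q ^ S c]. *)
Lemma angle_phi_angle_flux j c : q ^ (S c) * angle_phi j (S c) <= angle_flux j c - angle_flux j (S c).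
Proof.
pose proof sqrt_q_01 as [H E].
pose proof (root_gap_pos (S c)) as Hg; pose proof (K_pos j) as HK.
pose proof (fact_pos (2 * j)) as Hf.
pose proof (theta_sub_odd c) as D.
set (x := theta (2 * c + 1)) in *; set (y := theta (2 * S c + 1)) in *.
assert (Hn : 0 < INR (2 * j + 1)) by (apply lt_0_INR; lia).
assert (P : INR (2 * j + 1) * (x - y) * theta (2 * S c) ^ (2 * j) <=
   x ^ (2 * j + 1) - y ^ (2 * j + 1)).
{ rewrite Nat.add_1_r; apply pow_sub_ge; [|apply theta_ge0|].
  - split; [apply theta_ge0|]; unfold x, y.
    replace (2 * S c + 1)%nat with (S (S (2 * c + 1))) by lia.
    eapply Rle_trans; apply theta_decr.
  - unfold x, y; replace (2 * S c)%nat with (S (2 * c + 1)) by lia.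
    replace (S (2 * c + 1) + 1)%nat with (S (S (2 * c + 1))) by lia.
    apply theta_logconvex. }
unfold angle_phi, angle_flux; fold x y h; rewrite fact_odd.
set (T := theta (2 * S c) ^ (2 * j)) in *.
assert (HT : 0 <= T) by (apply pow_le, theta_ge0).
assert (Hy : 0 <= y ^ (2 * j + 1)) by (apply pow_le, theta_ge0).
pose proof (pow_range h (S c) H) as Hh.
rewrite <- pow_hh; change (h ^ S (S c)) with (h * h ^ S c).
set (K := (32 / (1 - q)) ^ j) in *; set (F := INR (fact (2 * j))) in *.
set (N := INR (2 * j + 1)) in *; set (hc := h ^ S c) in *.
set (g := root_gap (S c)) in *; set (X := x ^ (2 * j + 1)) in *.
set (Y := y ^ (2 * j + 1)) in *; fold e.
assert (He : 0 < e) by (unfold e; lra).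
apply Rle_trans with (K * (4 / e) * hc * (X - Y) / (N * F)).
- apply Rle_trans with (K * (4 / e) * hc * (N * (hc * e / (4 * g)) * T) / (N * F)).
  + right; field; repeat split; lra.
  + apply Rmult_le_compat_r; [left; apply Rinv_0_lt_compat; nra|].
    apply Rmult_le_compat_l.
    * assert (0 < 4 / e) by (apply Rdiv_lt_0_compat; lra).
      apply Rmult_le_pos; [apply Rmult_le_pos|]; lra.
    * eapply Rle_trans; [|exact P].
      apply Rmult_le_compat_r; [lra|]; apply Rmult_le_compat_l; lra.
(* Raising the prefactor [h ^ S (S c)] of the second flux to [h ^ S c] only lowers the
   difference. *)
- unfold Rdiv at 3 5; rewrite <- Rmult_minus_distr_r.
  apply Rmult_le_compat_r; [left; apply Rinv_0_lt_compat; nra|].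
  assert (0 < K * (4 / e)) by (apply Rmult_lt_0_compat; [|apply Rdiv_lt_0_compat]; lra).
  set (Z := K * (4 / e)) in *.
  assert (0 <= Z * hc) by (apply Rmult_le_pos; lra).
  assert (0 <= Z * hc * Y) by (apply Rmult_le_pos; lra).
  nra.
Qed.

(** The factor [1 - q ^ S a = root_gap a * root_gap a] cancels one [root_gap] from [theta_sub_even]
    and, up to a factor 2, one from the amplitude. *)
Lemma angle_flux_angle_phi j a : (1 - q) * angle_flux j a <=
  (1 - q ^ (S a)) * (angle_phi (S j) a - angle_phi (S j) (S a)).
Proof.
pose proof sqrt_q_01 as [H E].
pose proof (root_gap_pos (S a)) as Hg'; pose proof (root_gap_pos a) as Hg.
pose proof (root_gap_incr a) as Hgg; pose proof (K_pos j) as HK.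
pose proof (fact_pos (2 * j + 1)) as Hf.
pose proof (theta_sub_even a) as D.
pose proof (theta_even_decr a) as Dy.
set (x := theta (2 * a)) in *; set (y := theta (2 * S a)) in *.
set (n := theta (2 * a + 1)).
assert (Hn0 : 0 <= n) by apply theta_ge0.
assert (Hy0 : 0 <= y) by apply theta_ge0.
assert (Hn : 0 < INR (2 * j + 2)) by (apply lt_0_INR; lia).
assert (P : INR (2 * j + 2) * (x - y) * n ^ (2 * j + 1) <=
   x ^ (2 * S j) - y ^ (2 * S j)).
{ replace (2 * S j)%nat with (S (2 * j + 1)) by lia.
  replace (2 * j + 2)%nat with (S (2 * j + 1)) by lia.
  apply pow_sub_ge; [lra|lra|].
  unfold n, x, y; rewrite Nat.add_1_r.
  replace (2 * S a)%nat with (S (S (2 * a))) by lia.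
  apply theta_logconvex. }
unfold angle_phi, angle_flux; fold x y n h.
assert (EF : INR (fact (2 * S j)) = INR (2 * j + 2) * INR (fact (2 * j + 1))).
{ rewrite <- mult_INR; f_equal.
  replace (2 * S j)%nat with (S (2 * j + 1)) by lia.
  replace (2 * j + 2)%nat with (S (2 * j + 1)) by lia; reflexivity. }
rewrite EF; rewrite <- root_gap_sqr; fold e.
change ((32 / e) ^ S j) with (32 / e * (32 / e) ^ j); fold e in HK.
assert (Hx : 0 <= x ^ (2 * S j)) by (apply pow_le; lra).
assert (HY : 0 <= n ^ (2 * j + 1)) by (apply pow_le; lra).
pose proof (pow_range h a H) as Hh.
change (h ^ S a) with (h * h ^ a).
set (K := (32 / e) ^ j) in *; set (F := INR (fact (2 * j + 1))) in *.
set (N := INR (2 * j + 2)) in *; set (ha := h ^ a) in *.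
set (g := root_gap a) in *; set (g' := root_gap (S a)) in *.
set (X := x ^ (2 * S j)) in *; set (Y := y ^ (2 * S j)) in *.
set (T := n ^ (2 * j + 1)) in *.
assert (He : 0 < e) by (unfold e; lra).
assert (HKe : 0 < 32 / e) by (apply Rdiv_lt_0_compat; lra).
assert (HNF : 0 < N * F) by nra.
apply Rle_trans with (g * g * (32 / e * K * (N * (ha * e / (4 * g)) * T) / (N * F * g'))).
- replace (e * (K * (4 / e) * (h * ha) * T / F)) with
    (K * ha * T / F * (4 * h)) by (field; lra).
  replace (g * g * (32 / e * K * (N * (ha * e / (4 * g)) * T) / (N * F * g'))) with
    (K * ha * T / F * (8 * (g / g'))) by (field; repeat split; lra).
  apply Rmult_le_compat_l.
  + apply Rmult_le_pos; [|left; apply Rinv_0_lt_compat; lra].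
    apply Rmult_le_pos; [apply Rmult_le_pos|]; lra.
  + assert (1 / 2 <= g / g'); [|lra].
    apply Rmult_le_reg_r with g'; [lra|].
    unfold Rdiv; rewrite (Rmult_assoc g), Rinv_l; lra.
- apply Rmult_le_compat_l; [nra|].
  (* The amplitude at [a] is lowered to the one at [S a], so that both terms share a denominator. *)
  apply Rle_trans with (32 / e * K * (X - Y) / (N * F * g')).
  + apply Rmult_le_compat_r; [left; apply Rinv_0_lt_compat; nra|].
    apply Rmult_le_compat_l; [nra|].
    eapply Rle_trans; [|exact P].
    apply Rmult_le_compat_r; [lra|]; apply Rmult_le_compat_l; lra.
  + replace (32 / e * K * (X - Y) / (N * F * g')) with
      (32 / e * K * X / (N * F * g') - 32 / e * K * Y / (N * F * g'))
      by (field; repeat split; lra).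
    apply Rplus_le_compat_r.
    apply Rmult_le_compat_l; [apply Rmult_le_pos; [apply Rmult_le_pos|]; lra|].
    apply Rinv_le_contravar; nra.
Qed.

Lemma angle_phi_at0 j :
  angle_phi j 0 = (32 / (1 - q)) ^ j / (INR (fact (2 * j)) * sqrt (1 - q)).
Proof.
unfold angle_phi, root_gap; rewrite Nat.mul_0_r, theta_0, pow1, pow_1, Rmult_1_r.
reflexivity.
Qed.

End AngleFamily.

(** * Asymptotics of the bounds *)

Lemma nat_floor x : 0 <= x -> exists k : nat, INR k <= x < INR k + 1.
Proof.
intros Hx; destruct (archimed x) as [H1 H2].
assert (Hz : (0 < up x)%Z) by (apply lt_IZR; lra).
exists (Z.to_nat (up x - 1)).
rewrite INR_IZR_INZ, Z2Nat.id, minus_IZR by lia; lra.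
Qed.

Lemma exp_le1 x : x <= 0 -> exp x <= 1.
Proof. intros; apply Rle_trans with (exp 0); [apply exp_le_compat; lra|rewrite exp_0; lra]. Qed.

Lemma exp_opp_le x : 0 <= x -> exp (- x) <= / (1 + x).
Proof.
intros; rewrite exp_Ropp; apply Rinv_le_contravar; [lra|].
apply exp_ineq1_le.
Qed.

Lemma pow_unit x n : 0 <= x <= 1 -> 0 <= x ^ n <= 1.
Proof. intros H; split; [apply pow_le; lra|]; rewrite <- (pow1 n); apply pow_incr, H. Qed.

Lemma one_minus_pow_le p n : 0 <= p <= 1 -> (1 - p) ^ n <= exp (- (INR n * p)).
Proof.
intros Hp; replace (- (INR n * p)) with (INR n * - p) by ring.
rewrite <- exp_pow; apply pow_incr; split; [lra|].
pose proof (exp_ineq1_le (- p)); lra.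
Qed.

(** The chain is [(1 - p) ^ n <= exp (- y) <= / (1 + y) <= 1 - y / 2]. *)
Lemma one_minus_pow_ge p y n : 0 <= p <= 1 -> 0 <= y <= 1 -> y <= INR n * p ->
  y / 2 <= 1 - (1 - p) ^ n.
Proof.
intros Hp Hy Hyn; pose proof (one_minus_pow_le p n Hp) as H.
assert (H1 : exp (- (INR n * p)) <= exp (- y)) by (apply exp_le_compat; lra).
pose proof (exp_opp_le y (proj1 Hy)) as H2.
assert (H3 : / (1 + y) <= 1 - y / 2).
{ apply Rmult_le_reg_r with (1 + y); [lra|]; rewrite Rinv_l by lra; nra. }
lra.
Qed.

Lemma pow_ge_exp q n x : 0 < q < 1 -> 1 - q <= 1 / 2 ->
  2 * ((1 - q) * INR n) <= x -> exp (- x) <= q ^ n.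
Proof.
intros Hq He Hx.
assert (H : exp (- (2 * (1 - q))) <= q).
{ eapply Rle_trans; [apply exp_opp_le; lra|].
  apply Rmult_le_reg_r with (1 + 2 * (1 - q)); [lra|].
  rewrite Rinv_l by lra; nra. }
apply Rle_trans with (exp (- (2 * (1 - q))) ^ n).
- rewrite exp_pow; apply exp_le_compat; lra.
- apply pow_incr; split; [left; apply exp_pos|exact H].
Qed.

Lemma exp1_ge2 : 2 <= exp 1.
Proof. pose proof (exp_ineq1_le 1); lra. Qed.

Lemma sqr_le_exp_half x : 0 <= x -> x * x <= 16 * exp (x / 2).
Proof.
intros Hx; replace (x / 2) with (x / 4 + x / 4) by field; rewrite exp_plus.
pose proof (exp_ineq1_le (x / 4)); nra.
Qed.

(** Weak Stirling bound; the induction step is [(1 + / M) ^ M <= exp 1]. *)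
Lemma fact_ge_exp m : INR m ^ m * exp (- INR m) <= INR (fact m).
Proof.
induction m as [|m IH].
- simpl; rewrite Ropp_0, exp_0; lra.
- rewrite fact_simpl, mult_INR.
  assert (Hm : 0 < INR (S m)) by (apply lt_0_INR; lia).
  change (INR (S m) ^ S m) with (INR (S m) * INR (S m) ^ m).
  rewrite Rmult_assoc; apply Rmult_le_compat_l; [lra|].
  eapply Rle_trans; [|exact IH].
  destruct m as [|m].
  { simpl; rewrite Ropp_0, exp_0, !Rmult_1_l.
    apply exp_le1; lra. }
  assert (Hm' : 0 < INR (S m)) by (apply lt_0_INR; lia).
  rewrite (S_INR (S m)).
  set (M := INR (S m)) in *.
  replace (- (M + 1)) with (- (1) + - M) by ring; rewrite exp_plus, <- Rmult_assoc.
  apply Rmult_le_compat_r; [left; apply exp_pos|].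
  apply Rle_trans with ((M * exp (/ M)) ^ S m * exp (- (1))).
  + apply Rmult_le_compat_r; [left; apply exp_pos|].
    apply pow_incr; split; [lra|].
    pose proof (exp_ineq1_le (/ M)).
    assert (M * (1 + / M) = M + 1) by (field; lra). nra.
  + rewrite Rpow_mult_distr, exp_pow; fold M.
    rewrite Rinv_r, Rmult_assoc, <- exp_plus by lra.
    replace (1 + - (1)) with 0 by ring; rewrite exp_0; lra.
Qed.

(** Stirling bounds the quotient by [(8 * exp 1 ^ 2 / (e * j ^ 2)) ^ j], and [exp 1 <= 3] gives
    [72 = 8 * 9]. *)
Lemma pow_div_fact_le e j t : 0 < e -> (0 < j)%nat ->
  72 * exp t <= e * (INR j * INR j) ->
  (32 / e) ^ j / INR (fact (2 * j)) <= exp (- (t * INR j)).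
Proof.
intros He Hj H.
assert (HJ : 0 < INR j) by (apply lt_0_INR; lia).
pose proof (fact_ge_exp (2 * j)) as Hf.
assert (Hp : 0 < INR (2 * j) ^ (2 * j) * exp (- INR (2 * j))).
{ apply Rmult_lt_0_compat; [|apply exp_pos].
  apply pow_lt, lt_0_INR; lia. }
apply Rle_trans with ((32 / e) ^ j / (INR (2 * j) ^ (2 * j) * exp (- INR (2 * j)))).
{ apply Rmult_le_compat_l; [|apply Rinv_le_contravar; lra].
  apply pow_le; left; apply Rdiv_lt_0_compat; lra. }
assert (E : (32 / e) ^ j / (INR (2 * j) ^ (2 * j) * exp (- INR (2 * j))) =
  (8 * (exp 1 * exp 1) / (e * (INR j * INR j))) ^ j).
{ rewrite mult_INR, pow_mult; simpl (INR 2).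
  replace (- ((1 + 1) * INR j)) with (INR j * - (1 + 1)) by ring.
  rewrite <- exp_pow, <- Rpow_mult_distr; unfold Rdiv.
  rewrite <- pow_inv, <- Rpow_mult_distr; f_equal.
  rewrite exp_Ropp, exp_plus; pose proof (exp_pos 1); field; lra. }
rewrite E; replace (- (t * INR j)) with (INR j * - t) by ring.
rewrite <- exp_pow; pose proof exp_le_3; pose proof (exp_pos 1).
assert (0 < e * (INR j * INR j)) by (repeat apply Rmult_lt_0_compat; lra).
assert (exp 1 * exp 1 <= 3 * 3) by (apply Rmult_le_compat; lra).
assert (0 < exp 1 * exp 1) by (apply Rmult_lt_0_compat; lra).
apply pow_incr; split.
- left; apply Rdiv_lt_0_compat; lra.
- rewrite exp_Ropp; pose proof (exp_pos t).
  apply Rmult_le_reg_r with (e * (INR j * INR j)); [lra|].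
  unfold Rdiv; rewrite Rmult_assoc, Rinv_l, Rmult_1_r by lra.
  apply Rmult_le_reg_l with (exp t); [lra|].
  rewrite <- (Rmult_assoc (exp t) (/ exp t)), Rinv_r, Rmult_1_l by lra.
  assert (exp t * (8 * (exp 1 * exp 1)) <= exp t * 72)
    by (apply Rmult_le_compat_l; lra).
  lra.
Qed.

Lemma ln_le x y : 0 < x -> x <= y -> ln x <= ln y.
Proof. intros H [H1| ->]; [left; apply ln_increasing; lra|right; reflexivity]. Qed.

(** [exp 1] lies strictly between 2 and 3, so [ln (ln n)] stays away from zero. In the third regime
    this makes the constants uniform down to [n = 2]. *)
Lemma lnln_away : exists k0, 0 < k0 /\
  forall n : nat, (2 <= n)%nat -> k0 <= Rabs (ln (ln (INR n))).
Proof.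
(* From [1 - 1/6 < exp (- 1/6)] one gets [exp 1 <= (6/5) ^ 6 < 3]. *)
assert (e3 : exp 1 < 3).
{ assert (H : 5 / 6 < exp (- (1 / 6))).
  { pose proof (exp_ineq1 (- (1 / 6)) ltac:(lra)); lra. }
  assert (H6 : (5 / 6) ^ 6 <= exp (- (1 / 6)) ^ 6) by (apply pow_incr; lra).
  rewrite exp_pow in H6; simpl (INR 6) in H6.
  replace ((1 + 1 + 1 + 1 + 1 + 1) * - (1 / 6)) with (- (1)) in H6 by field.
  rewrite exp_Ropp in H6; pose proof (exp_pos 1).
  assert ((5 / 6) ^ 6 * exp 1 <= 1).
  { replace 1 with (/ exp 1 * exp 1) at 2 by (field; lra).
    apply Rmult_le_compat_r; lra. }
  simpl in *; lra. }
assert (e2 : 2 < exp 1) by (pose proof (exp_ineq1 1 ltac:(lra)); lra).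
assert (l2 : 0 < ln 2 < 1).
{ split; [rewrite <- ln_1; apply ln_increasing; lra|].
  rewrite <- (ln_exp 1); apply ln_increasing; lra. }
assert (l3 : 1 < ln 3) by (rewrite <- (ln_exp 1) at 1; apply ln_increasing; lra).
assert (u2 : ln (ln 2) < 0) by (rewrite <- ln_1; apply ln_increasing; lra).
assert (u3 : 0 < ln (ln 3)) by (rewrite <- ln_1; apply ln_increasing; lra).
exists (Rmin (- ln (ln 2)) (ln (ln 3))); split.
- apply Rmin_glb_lt; lra.
- intros n Hn; destruct (Nat.eq_dec n 2) as [->|Hn2].
  + simpl (INR 2); replace (1 + 1) with 2 by ring.
    rewrite Rabs_left by lra; apply Rmin_l.
  + assert (H3 : 3 <= INR n) by (replace 3 with (INR 3) by (simpl; ring); apply le_INR; lia).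
    eapply Rle_trans; [apply Rmin_r|]; eapply Rle_trans; [|apply Rle_abs].
    assert (ln 3 <= ln (INR n)) by (apply ln_le; lra).
    apply ln_le; lra.
Qed.

Lemma ln_le_sub1 x : 0 < x -> ln x <= x - 1.
Proof.
intros; rewrite <- (exp_ln x) at 2 by lra.
pose proof (exp_ineq1_le (ln x)); lra.
Qed.

Lemma ln_inv_ge q : 0 < q < 1 -> 1 - q <= ln (1 / q).
Proof.
intros; unfold Rdiv; rewrite Rmult_1_l, ln_Rinv by lra.
pose proof (ln_le_sub1 q ltac:(lra)); lra.
Qed.

(** * The regimes, from abstract inequalities on a number [E] *)

Section Regimes.
(** [E] stands for the expectation, seen only through these bounds and one more taken by
    [regime4_lower]. [upA] and [upB] come from the two families; in the lower bounds a block has [k]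
    windows of length [w], and [B] counts blocks. *)
Variables (n : nat) (q E : R).
Hypotheses (n2 : (2 <= n)%nat) (q01 : 0 < q < 1).
Hypothesis E_ge1 : 1 <= E.
Hypothesis upA : forall j, E <= INR j + INR n * geo_phi q j 0.
Hypothesis upB : forall j, E <= INR j +
  INR n * ((32 / (1 - q)) ^ j / (INR (fact (2 * j)) * sqrt (1 - q))).
Hypothesis low_lin : forall k w, (4 * (k * w) <= n)%nat ->
  INR k * (1 - (1 - q ^ (2 * (k * w)) * (1 - q ^ w)) ^ w) <= E.
Hypothesis low_blk : forall k w B, (0 < k)%nat -> ((B + 3) * (k * w) <= n)%nat ->
  INR k * (1 - (1 - (1 - (1 - q ^ (2 * (k * w)) * (1 - q ^ w)) ^ w) ^ k) ^ B) <= E.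

Let N := INR n.
Let L := ln N.
Let e := 1 - q.

Lemma N_ge2 : 2 <= N.
Proof. unfold N; replace 2 with (INR 2) by (simpl; ring); apply le_INR; exact n2. Qed.

Lemma L_gt0 : 0 < L.
Proof. pose proof N_ge2; unfold L; rewrite <- ln_1; apply ln_increasing; lra. Qed.

Lemma exp_L : exp L = N.
Proof. pose proof N_ge2; unfold L; apply exp_ln; lra. Qed.

Lemma e_01 : 0 < e < 1.
Proof. unfold e; lra. Qed.

Lemma sqrt_e_facts : 0 < sqrt e <= 1 /\ sqrt e * sqrt e = e.
Proof.
pose proof e_01; split; [|apply sqrt_sqrt; lra].
split; [apply sqrt_lt_R0; lra|].
apply Rle_trans with (sqrt 1); [apply sqrt_le_1; lra|rewrite sqrt_1; lra].
Qed.

Lemma q_pow_01 m : 0 < q ^ m <= 1.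
Proof. apply pow_01; exact q01. Qed.

Lemma pick_range k w : 0 <= q ^ (2 * (k * w)) * (1 - q ^ w) <= 1.
Proof.
pose proof (q_pow_01 (2 * (k * w))); pose proof (q_pow_01 w).
set (x := q ^ (2 * (k * w))) in *; set (y := q ^ w) in *; nra.
Qed.

Lemma gap_pow_ge w : e * INR w <= 1 -> e * INR w / 2 <= 1 - q ^ w.
Proof.
intros H; pose proof e_01; pose proof (pos_INR w).
replace q with (1 - e) by (unfold e; ring).
apply one_minus_pow_ge; [lra| |lra]; nra.
Qed.

(* A window of [w] entries, entered at level at most [2 k w <= 2 x / e], lengthens
   the chain with probability of order [e w^2]. *)
Lemma pick_prob_ge k w x y : e <= 1 / 2 ->
  e * (INR k * INR w) <= x -> e * INR w <= 1 -> 0 <= y <= 1 ->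
  y <= exp (- (4 * x)) * (e * (INR w * INR w) / 2) ->
  y / 2 <= 1 - (1 - q ^ (2 * (k * w)) * (1 - q ^ w)) ^ w.
Proof.
intros He Hx Hw Hy H1.
pose proof e_01; pose proof (pos_INR w); pose proof (exp_pos (- (4 * x))).
apply one_minus_pow_ge; [apply pick_range|exact Hy|].
eapply Rle_trans; [exact H1|].
assert (G : exp (- (4 * x)) <= q ^ (2 * (k * w))).
{ apply pow_ge_exp; [exact q01|exact He|].
  rewrite !mult_INR; simpl (INR 2); fold e; lra. }
pose proof (gap_pow_ge w Hw) as G2.
set (X := q ^ (2 * (k * w))) in *; set (Z := 1 - q ^ w) in *.
assert (exp (- (4 * x)) * (e * INR w / 2) <= X * Z).
{ apply Rmult_le_compat; nra. }
nra.
Qed.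

(** With [w] about [1 / sqrt e] and [k] about half of it, [e * k * w <= 1/2] while [e * w ^ 2] is of
    order one, so each window succeeds with probability at least [exp (-2) / 16]. *)
Lemma regime1_lower : 4 / N <= e -> exp (-2) / 64 * (1 / sqrt e) <= E.
Proof.
intros He; pose proof e_01; destruct sqrt_e_facts as [Hs Es].
pose proof N_ge2; pose proof (exp_pos (-2)).
assert (Hexp : exp (-2) <= 1) by (apply exp_le1; lra).
set (s := 1 / sqrt e).
assert (Hss : s * s = 1 / e) by (unfold s; replace (1 / e) with (1 / (sqrt e * sqrt e)) by (rewrite Es; reflexivity); field; lra).
assert (Hs0 : 1 <= s).
{ unfold s; apply Rmult_le_reg_r with (sqrt e); [lra|].
  unfold Rdiv; rewrite Rmult_assoc, Rinv_l; lra. }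
destruct (Rle_dec s 2) as [s2|s2]; [nra|].
destruct (nat_floor s) as [w Hw]; [lra|].
destruct (nat_floor (s / 2)) as [k Hk]; [lra|].
assert (k1 : 1 <= INR k).
{ destruct k; [simpl in Hk; lra|]; rewrite S_INR; pose proof (pos_INR k); lra. }
assert (Ess : e * (s * s) = 1) by (rewrite Hss; field; lra).
assert (He4 : e <= 1 / 4) by nra.
assert (H4 : (4 * (k * w) <= n)%nat).
{ apply INR_le; rewrite !mult_INR; replace (INR 4) with 4 by (simpl; ring); fold N.
  assert (4 <= e * N).
  { replace 4 with (4 / N * N) by (field; lra); apply Rmult_le_compat_r; lra. }
  assert (INR k * INR w <= s / 2 * s) by (apply Rmult_le_compat; lra).
  assert (e * (4 * (INR k * INR w)) <= e * N) by nra.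
  apply Rmult_le_reg_l with e; lra. }
pose proof (low_lin k w H4) as HE.
assert (Hws : INR w * INR w <= s * s) by (apply Rmult_le_compat; lra).
assert (Hws' : s * s / 4 <= INR w * INR w).
{ replace (s * s / 4) with (s / 2 * (s / 2)) by field; apply Rmult_le_compat; lra. }
assert (Hew : e * (INR w * INR w) <= 1) by nra.
assert (Hew' : 1 / 4 <= e * (INR w * INR w)) by nra.
assert (Q1 : e * (INR k * INR w) <= 1 / 2).
{ assert (INR k * INR w <= s / 2 * s) by (apply Rmult_le_compat; lra). nra. }
assert (Q2 : e * INR w <= 1) by nra.
pose proof (pick_prob_ge k w (1 / 2) (exp (-2) / 8) ltac:(lra) Q1 Q2 ltac:(lra)) as HP.
replace (- (4 * (1 / 2))) with (-2) in HP by field.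
specialize (HP ltac:(nra)).
set (P := 1 - (1 - q ^ (2 * (k * w)) * (1 - q ^ w)) ^ w) in *.
assert (HP' : exp (-2) / 16 <= P) by lra.
assert (s / 4 <= INR k) by lra.
apply Rle_trans with (INR k * P); [|exact HE].
replace (exp (-2) / 64 * s) with (s / 4 * (exp (-2) / 16)) by field.
apply Rmult_le_compat; lra.
Qed.

Lemma upB_exp j t : (0 < j)%nat -> 72 * exp t <= e * (INR j * INR j) ->
  E <= INR j + exp (L - t * INR j) * (1 / sqrt e).
Proof.
intros Hj Ht; destruct sqrt_e_facts as [Hs _].
eapply Rle_trans; [apply (upB j)|]; apply Rplus_le_compat_l.
pose proof (pow_div_fact_le e j t (proj1 e_01) Hj Ht) as H.
pose proof N_ge2; pose proof (INR_fact_lt_0 (2 * j)).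
fold N e; unfold Rminus; rewrite exp_plus, exp_L, Rmult_assoc.
apply Rmult_le_compat_l; [lra|].
replace ((32 / e) ^ j / (INR (fact (2 * j)) * sqrt e)) with
  ((32 / e) ^ j / INR (fact (2 * j)) * (1 / sqrt e)) by (field; lra).
apply Rmult_le_compat_r; [|exact H].
left; apply Rdiv_lt_0_compat; lra.
Qed.

Lemma regime1_upper : e <= 100 / L ^ 2 -> E <= 102 * (1 / sqrt e).
Proof.
intros He; pose proof e_01; destruct sqrt_e_facts as [Hs Es]; pose proof L_gt0.
set (s := 1 / sqrt e).
assert (Hs1 : s * sqrt e = 1) by (unfold s; field; lra).
assert (Hs0 : 1 <= s) by nra.
assert (Ess : e * (s * s) = 1) by nra.
assert (HL : L <= 10 * s).
{ apply Rsqr_incr_0; unfold Rsqr; [|lra|lra].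
  assert (e * (L * L) <= 100).
  { replace 100 with (100 / L ^ 2 * (L * L)) by (field; lra).
    apply Rmult_le_compat_r; nra. }
  apply Rmult_le_reg_l with e; [lra|]; nra. }
(* [upB_exp] is used with [t = 1]: [72 * exp 1 <= 100 ^ 2], and [L <= 10 * s] makes its exponential
   at most one. *)
destruct (nat_floor (100 * s)) as [j Hj]; [lra|].
pose proof exp_le_3.
assert (H72 : 72 * exp 1 <= e * (INR (S j) * INR (S j))).
{ rewrite S_INR.
  assert (100 * s * (100 * s) <= (INR j + 1) * (INR j + 1))
    by (apply Rmult_le_compat; lra).
  assert (e * (100 * s * (100 * s)) <= e * ((INR j + 1) * (INR j + 1)))
    by (apply Rmult_le_compat_l; lra).
  nra. }
pose proof (upB_exp (S j) 1 ltac:(lia) H72) as U.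
rewrite S_INR in U.
assert (X : exp (L - 1 * (INR j + 1)) <= 1)
  by (apply exp_le1; lra).
fold s in U; nra.
Qed.

(** With [rho = N ^ (1/4)], a block succeeds with probability at least [/ rho] and has length at
    most [rho ^ 2]. More than [rho] blocks fit, as [rho + 4 <= rho ^ 2], and one succeeds with
    probability at least one half. *)
Lemma lower_blocks k w lam : (0 < k)%nat -> 8 <= L ->
  INR k * INR w <= exp (L / 2) ->
  exp (- lam) <= 1 - (1 - q ^ (2 * (k * w)) * (1 - q ^ w)) ^ w ->
  INR k * lam <= L / 4 -> INR k / 2 <= E.
Proof.
intros Hk HL Hkw Hp Hlam.
set (rho := exp (L / 4)).
assert (R3 : 3 <= rho).
{ unfold rho; pose proof (exp_ineq1_le (L / 4)); lra. }
assert (E2 : exp (L / 2) = rho * rho)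
  by (unfold rho; rewrite <- exp_plus; f_equal; field).
assert (E4 : N = rho * rho * (rho * rho)).
{ rewrite <- E2, <- exp_plus, <- exp_L; f_equal; field. }
destruct (nat_floor rho) as [B0 HB]; [lra|].
assert (H : ((S B0 + 3) * (k * w) <= n)%nat).
{ apply INR_le; rewrite !mult_INR, plus_INR, S_INR; fold N.
  replace (INR 3) with 3 by (simpl; ring).
  rewrite E4; rewrite E2 in Hkw; pose proof (pos_INR B0).
  assert (0 <= INR k * INR w) by (apply Rmult_le_pos; apply pos_INR).
  apply Rmult_le_compat; try lra; nra. }
pose proof (low_blk k w (S B0) Hk H) as HE.
set (P := 1 - (1 - q ^ (2 * (k * w)) * (1 - q ^ w)) ^ w) in *.
assert (P01 : 0 <= P <= 1).
{ unfold P; pose proof (pick_range k w) as HR.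
  assert (0 <= (1 - q ^ (2 * (k * w)) * (1 - q ^ w)) ^ w <= 1); [|lra].
  apply pow_unit; lra. }
assert (Pk : exp (- (L / 4)) <= P ^ k).
{ apply Rle_trans with (exp (- lam) ^ k).
  - rewrite exp_pow; apply exp_le_compat; lra.
  - apply pow_incr; split; [left; apply exp_pos|exact Hp]. }
pose proof (pow_unit P k P01) as Pk1.
assert (F : 1 / 2 <= 1 - (1 - P ^ k) ^ S B0).
{ apply one_minus_pow_ge; [exact Pk1|lra|].
  rewrite S_INR; rewrite exp_Ropp in Pk; fold rho in Pk.
  apply Rle_trans with (rho * / rho); [rewrite Rinv_r; lra|].
  apply Rmult_le_compat; try lra.
  left; apply Rinv_0_lt_compat; lra. }
pose proof (pos_INR k); nra.
Qed.

Lemma pick_prob1 k :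
  1 - (1 - q ^ (2 * (k * 1)) * (1 - q ^ 1)) ^ 1 = q ^ (2 * k) * e.
Proof. rewrite Nat.mul_1_r, !pow_1; unfold e; ring. Qed.

(** * Second regime *)

Section Regime2.
Let Y := e * L ^ 2.
Let v := ln Y.
Let b := L / v.
Hypothesis HY : 100 <= Y.

Lemma v_facts : 4 <= v /\ exp v = Y /\ 10 <= L /\ v <= 2 * L.
Proof.
pose proof e_01; pose proof L_gt0.
assert (Ev : exp v = Y) by (unfold v; apply exp_ln; lra).
assert (L10 : 10 <= L).
{ apply Rsqr_incr_0; unfold Rsqr; try lra; unfold Y in HY; simpl in HY; nra. }
repeat split; try assumption.
- rewrite <- (ln_exp 4); apply ln_le; [apply exp_pos|].
  apply Rle_trans with 81; [|lra].
  replace 4 with (INR 4 * 1) by (simpl; ring); rewrite <- exp_pow.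
  replace 81 with (3 ^ 4) by ring; apply pow_incr; split;
    [left; apply exp_pos|apply exp_le_3].
- apply Rle_trans with (ln (L * L)).
  + apply ln_le; [lra|]; unfold Y; simpl; nra.
  + rewrite ln_mult by lra; pose proof (ln_le_sub1 L ltac:(lra)); lra.
Qed.

(** Take [t = v / 2] in [upB_exp]. From [exp v = Y = e * b ^ 2 * v ^ 2] and
    [v ^ 2 <= 16 * exp (v / 2)] follows [exp (v / 2) <= 16 * e * b ^ 2], so [j] above [100 * b] is
    admissible; the exponent is then at most [- 49 * L], which also absorbs [1 / sqrt e]. *)
Lemma regime2_upper : E <= 104 * b.
Proof.
pose proof e_01; destruct v_facts as [Hv [Ev [HL Hv2]]].
destruct sqrt_e_facts as [Hs Es].
assert (Hbv : b * v = L) by (unfold b; field; lra).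
assert (Hb : 1 / 2 <= b).
{ apply Rmult_le_reg_r with v; lra. }
destruct (nat_floor (100 * b)) as [j Hj]; [lra|].
assert (H72 : 72 * exp (v / 2) <= e * (INR (S j) * INR (S j))).
{ rewrite S_INR.
  assert (B1 : 100 * b * (100 * b) <= (INR j + 1) * (INR j + 1))
    by (apply Rmult_le_compat; lra).
  assert (B2 : e * (100 * b * (100 * b)) <= e * ((INR j + 1) * (INR j + 1)))
    by (apply Rmult_le_compat_l; lra).
  eapply Rle_trans; [|exact B2].
  pose proof (sqr_le_exp_half v ltac:(lra)) as Sq.
  pose proof (exp_pos (v / 2)).
  assert (Ee : exp v = exp (v / 2) * exp (v / 2))
    by (rewrite <- exp_plus; f_equal; field).
  assert (EY : e * (b * b) * (v * v) = exp (v / 2) * exp (v / 2)).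
  { rewrite <- Ee, Ev; unfold Y; rewrite <- Hbv; ring. }
  assert (0 <= e * (b * b)) by (apply Rmult_le_pos; nra).
  assert (e * (b * b) * (v * v) <= e * (b * b) * (16 * exp (v / 2)))
    by (apply Rmult_le_compat_l; lra).
  assert (exp (v / 2) <= 16 * (e * (b * b))).
  { apply Rmult_le_reg_r with (exp (v / 2)); lra. }
  lra. }
pose proof (upB_exp (S j) (v / 2) ltac:(lia) H72) as U.
assert (T : 50 * L <= v / 2 * INR (S j)).
{ rewrite S_INR; assert (100 * b * v <= (INR j + 1) * v)
    by (apply Rmult_le_compat_r; lra). lra. }
assert (Se : 1 / sqrt e <= exp L).
{ apply Rle_trans with L; [|pose proof (exp_ineq1_le L); lra].
  apply Rmult_le_reg_r with (sqrt e); [lra|].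
  unfold Rdiv; rewrite Rmult_assoc, Rinv_l, Rmult_1_r by lra.
  assert (1 * 1 <= (L * sqrt e) * (L * sqrt e)).
  { replace (L * sqrt e * (L * sqrt e)) with (L * L * (sqrt e * sqrt e)) by ring.
    rewrite Es; unfold Y in HY; simpl in HY; lra. }
  apply Rsqr_incr_0; unfold Rsqr; try lra; apply Rmult_le_pos; lra. }
assert (X : exp (L - v / 2 * INR (S j)) * (1 / sqrt e) <= 1).
{ apply Rle_trans with (exp (L - v / 2 * INR (S j)) * exp L).
  - apply Rmult_le_compat_l; [left; apply exp_pos|exact Se].
  - rewrite <- exp_plus; apply exp_le1; lra. }
rewrite S_INR in *; lra.
Qed.

Lemma regime2_lower : e <= 1 / 8 * (ln L) ^ 2 / L -> 1 / 64 * b <= E.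
Proof.
intros He; pose proof e_01; destruct v_facts as [Hv [Ev [HL Hv2]]].
assert (Hbv : b * v = L) by (unfold b; field; lra).
assert (Hb : 1 / 2 <= b) by (apply Rmult_le_reg_r with v; lra).
destruct (nat_floor (1 / 16 * b)) as [k Hk]; [lra|].
destruct (Nat.eq_dec k 0) as [->|k0]; [simpl in Hk; lra|].
assert (Hk1 : 1 <= INR k) by (change 1 with (INR 1); apply le_INR; lia).
enough (INR k / 2 <= E) by lra.
assert (HkL : INR k * v <= L / 16) by nra.
assert (EYL : Y = e * (L * L)) by (unfold Y; ring).
pose proof (sqr_le_exp_half L ltac:(lra)) as SqL.
assert (Hek2 : e * (INR k * INR k) * (v * v) <= Y / 256).
{ rewrite EYL.
  assert ((INR k * v) * (INR k * v) <= (L / 16) * (L / 16))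
    by (apply Rmult_le_compat; nra).
  assert (e * ((INR k * v) * (INR k * v)) <= e * ((L / 16) * (L / 16)))
    by (apply Rmult_le_compat_l; lra).
  lra. }
destruct (Rle_dec (INR k * e) (1 / 2)) as [ke|ke].
(* The longest windows with [e * k * w <= 1]. Then [e * w ^ 2] is at least of order
   [1 / (e * k ^ 2) >= / Y = exp (- v)], and the [8] in [8 + v] absorbs the constants. *)
- set (z := / (INR k * e)).
  assert (Hke0 : 0 < INR k * e) by nra.
  assert (Hz : z * (INR k * e) = 1) by (unfold z; field; lra).
  assert (Hz2 : 2 <= z) by nra.
  destruct (nat_floor z) as [w Hw]; [lra|].
  assert (Hkw : e * (INR k * INR w) <= 1).
  { assert (INR w * (INR k * e) <= z * (INR k * e))
      by (apply Rmult_le_compat_r; lra). lra. }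
  assert (Hwz : z / 2 <= INR w) by lra.
  assert (Hew : e * INR w <= 1) by nra.
  apply (lower_blocks k w (8 + v)); [lia|lra| | |].
  + assert (e * (INR k * INR w) * 100 <= e * (L * L)) by lra.
    assert (INR k * INR w * 100 <= L * L) by (apply Rmult_le_reg_l with e; lra).
    pose proof (exp_pos (L / 2)); lra.
  + assert (Ex4 : 16 * exp (-4) <= 1).
    { replace (-4) with (- (INR 4 * 1)) by (simpl; ring).
      rewrite exp_Ropp, <- exp_pow; pose proof exp1_ge2.
      assert (2 ^ 4 <= exp 1 ^ 4) by (apply pow_incr; lra).
      apply Rmult_le_reg_r with (exp 1 ^ 4); [lra|].
      rewrite Rmult_assoc, Rinv_l; lra. }
    assert (E8 : exp (- (8 + v)) = exp (-4) * exp (-4) * exp (- v))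
      by (rewrite <- !exp_plus; f_equal; ring).
    pose proof (exp_pos (-4)); pose proof (exp_pos (- v)).
    assert (EvY : exp (- v) * Y = 1) by (rewrite exp_Ropp, Ev; field; lra).
    assert (V1 : exp (- v) <= 1) by (apply exp_le1; lra).
    assert (W2 : exp (- v) / 8 <= e * (INR w * INR w) / 2).
    { assert (0 <= e * (INR k * INR k)) by (apply Rmult_le_pos; nra).
      assert (1 <= v * v) by nra.
      assert (Hek : e * (INR k * INR k) <= Y).
      { assert (e * (INR k * INR k) * 1 <= e * (INR k * INR k) * (v * v))
          by (apply Rmult_le_compat_l; lra). lra. }
      assert (z / 2 * (z / 2) <= INR w * INR w) by (apply Rmult_le_compat; lra).
      assert (e * (z / 2 * (z / 2)) <= e * (INR w * INR w))
        by (apply Rmult_le_compat_l; lra).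
      assert (exp (- v) <= e * (z * z)); [|lra].
      assert (Hzz : e * (z * z) * (e * (INR k * INR k)) = 1)
        by (replace (e * (z * z) * (e * (INR k * INR k))) with
              (z * (INR k * e) * (z * (INR k * e))) by ring; rewrite Hz; ring).
      assert (0 <= e * (z * z)) by (apply Rmult_le_pos; nra).
      assert (e * (z * z) * (e * (INR k * INR k)) <= e * (z * z) * Y)
        by (apply Rmult_le_compat_l; lra).
      apply Rmult_le_reg_r with Y; lra. }
    replace (exp (- (8 + v))) with (2 * exp (- (8 + v)) / 2) by field.
    apply (pick_prob_ge k w 1); [nra|exact Hkw|exact Hew| |].
    * rewrite E8; split; [|nra].
      apply Rmult_le_pos; [lra|]; apply Rmult_le_pos; nra.
    * replace (- (4 * 1)) with (-4) by ring; rewrite E8.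
      apply Rle_trans with (exp (-4) * (exp (- v) / 8)); [|nra].
      assert (16 * exp (-4) * exp (- v) <= 1 * exp (- v))
        by (apply Rmult_le_compat_r; lra).
      nra.
  + nra.
(* Windows now have a single entry and succeed with probability [q ^ (2 * k) * e]. Here [e * L >= 1]
   yields [exp (- v) <= e], while the upper limit on [e] yields [e <= 1/2] and
   [e * k ^ 2 <= L / 64]. *)
- assert (Hk2 : 1 / 2 < INR k * e) by lra.
  assert (HeL : 1 <= e * L).
  { assert (INR k * v * e <= L / 16 * e) by (apply Rmult_le_compat_r; lra). nra. }
  set (u := ln L) in *.
  assert (Huv : u <= v) by (apply ln_le; [lra|]; rewrite EYL; nra).
  assert (Hu0 : 0 <= u) by (unfold u; rewrite <- ln_1; apply ln_le; lra).
  assert (HeL4 : e * L <= u * u / 8).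
  { replace (u * u / 8) with (1 / 8 * u ^ 2 / L * L) by (field; lra).
    apply Rmult_le_compat_r; lra. }
  assert (He2 : e <= 1 / 2).
  { assert (Eu : exp u = L) by (unfold u; apply exp_ln; lra).
    assert (u * u <= 4 * L).
    { rewrite <- Eu; replace u with (u / 2 + u / 2) at 3 by field; rewrite exp_plus.
      pose proof (exp_ineq1_le (u / 2)); nra. }
    apply Rmult_le_reg_r with L; lra. }
  assert (Hexpe : exp (- v) <= e).
  { assert (EvY : exp (- v) * Y = 1) by (rewrite exp_Ropp, Ev; field; lra).
    apply Rmult_le_reg_r with Y; [lra|]; rewrite EvY, EYL; nra. }
  apply (lower_blocks k 1 (4 * (INR k * e) + v)); [lia|lra| | |].
  + simpl (INR 1); pose proof (exp_ineq1_le (L / 2)); nra.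
  + rewrite pick_prob1.
    replace (- (4 * (INR k * e) + v)) with (- (4 * (INR k * e)) + - v) by ring.
    rewrite exp_plus; apply Rmult_le_compat;
      [left; apply exp_pos|left; apply exp_pos| |exact Hexpe].
    apply pow_ge_exp; [exact q01|exact He2|].
    rewrite mult_INR; simpl (INR 2); fold e; lra.
  + assert (K1 : e * (INR k * INR k) <= L / 64).
    { apply Rmult_le_reg_r with (v * v); [nra|].
      eapply Rle_trans; [exact Hek2|]; rewrite EYL.
      assert (u * u <= v * v) by (apply Rmult_le_compat; lra).
      assert (L * (e * L) <= L * (v * v / 4)) by (apply Rmult_le_compat_l; lra).
      nra. }
    nra.
Qed.

End Regime2.

(** * Third regime *)

Section Regime3.
Variable k0 : R.
Hypotheses (k0_gt0 : 0 < k0) (k0_le : k0 <= Rabs (ln L)).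
Hypothesis He : 1 / 8 * (ln L) ^ 2 / L <= e.
Hypothesis Hq : 1 / N <= q.

Let l := ln (1 / q).
Let m := ln (1 / e).
Let b := sqrt (L / l).
(** The first two terms bound [b * m / L] for [ln L >= 1] and for [ln L < 1]; the last one bounds
    [b / L]. *)
Let K := 12 + 72 / k0 ^ 3 + 3 / k0.

(** The lower limit on [e] gives [(ln L) ^ 2 <= 8 * e * L], and [e <= l] gives [b * b * e <= L];
    hence [b * Rabs (ln L) <= 3 * L]. Moreover [m <= 3 + ln L] if [ln L >= 1], and
    [m <= 24 / (k0 * k0)] otherwise. *)
Lemma regime3_facts : 1 <= b /\ 0 < l /\ b * b * l = L /\ b <= K * L /\ b * m <= K * L /\ 0 < m.
Proof.
pose proof e_01; pose proof L_gt0 as HL; pose proof N_ge2.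
assert (Hl : e <= l) by (unfold l, e; apply ln_inv_ge, q01).
assert (HlL : l <= L).
{ unfold l, L; apply ln_le; [apply Rdiv_lt_0_compat; lra|].
  apply Rmult_le_reg_r with (q / N); [apply Rdiv_lt_0_compat; lra|].
  replace (1 / q * (q / N)) with (1 / N) by (field; lra).
  replace (N * (q / N)) with q by (field; lra); exact Hq. }
assert (HLl : 1 <= L / l).
{ apply Rmult_le_reg_r with l; [lra|].
  unfold Rdiv; rewrite Rmult_assoc, Rinv_l; lra. }
assert (Hbb : b * b = L / l) by (apply sqrt_sqrt; lra).
assert (Hb0 : 0 <= b) by apply sqrt_pos.
assert (Hb1 : 1 <= b) by nra.
assert (Hbl : b * b * l = L) by (rewrite Hbb; field; lra).
assert (Hbe : b * b * e <= L) by nra.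
assert (Hm : 0 < m).
{ unfold m; rewrite <- ln_1; apply ln_increasing; [lra|].
  apply Rmult_lt_reg_r with e; [lra|].
  unfold Rdiv; rewrite Rmult_assoc, Rinv_l; lra. }
set (u := ln L) in *.
assert (Hu : u * u <= 8 * (e * L)).
{ assert (1 / 8 * u ^ 2 / L * L <= e * L) by (apply Rmult_le_compat_r; lra).
  replace (1 / 8 * u ^ 2 / L * L) with (u * u / 8) in * by (field; lra). lra. }
assert (Hbu : b * Rabs u <= 3 * L).
{ apply Rsqr_incr_0; [|apply Rmult_le_pos; [lra|apply Rabs_pos]|lra].
  rewrite Rsqr_mult, <- Rsqr_abs; unfold Rsqr.
  assert (b * b * (u * u) <= b * b * (8 * (e * L)))
    by (apply Rmult_le_compat_l; nra).
  assert (b * b * e * L <= L * L) by (apply Rmult_le_compat_r; lra).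
  nra. }
assert (K1 : 0 < 72 / k0 ^ 3) by (apply Rdiv_lt_0_compat; [lra|apply pow_lt; lra]).
assert (K2 : 0 < 3 / k0) by (apply Rdiv_lt_0_compat; lra).
assert (Hbk : b <= 3 / k0 * L).
{ apply Rmult_le_reg_r with k0; [lra|].
  replace (3 / k0 * L * k0) with (3 * L) by (field; lra).
  eapply Rle_trans; [|exact Hbu]; apply Rmult_le_compat_l; lra. }
assert (Hku : k0 * k0 <= u * u).
{ replace (u * u) with (Rabs u * Rabs u)
    by (fold (Rsqr (Rabs u)); rewrite <- Rsqr_abs; reflexivity).
  apply Rmult_le_compat; lra. }
assert (Huu : 0 < u * u) by nra.
repeat split; try assumption; [lra|unfold K; nra|].
assert (Einv : 1 / e <= 8 * L / (u * u)).
{ apply Rmult_le_reg_r with (e * (u * u)); [apply Rmult_lt_0_compat; lra|].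
  replace (1 / e * (e * (u * u))) with (u * u) by (field; lra).
  replace (8 * L / (u * u) * (e * (u * u))) with (8 * (e * L))
    by (field; intros Hz; rewrite Hz in Huu; lra).
  exact Hu. }
assert (Hie : 0 < 1 / e) by (apply Rdiv_lt_0_compat; lra).
destruct (Rle_dec 1 u) as [u1|u1].
- rewrite Rabs_right in Hbu by lra.
  assert (Hmu : m <= 3 + u).
  { unfold m; apply Rle_trans with (ln (8 * L)).
    - apply ln_le; [lra|]; eapply Rle_trans; [exact Einv|].
      apply Rmult_le_reg_r with (u * u); [lra|].
      unfold Rdiv; rewrite Rmult_assoc, Rinv_l by lra.
      apply Rmult_le_compat_l; nra.
    - rewrite ln_mult by lra; fold u; apply Rplus_le_compat_r.
      rewrite <- (ln_exp 3); apply ln_le; [lra|].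
      replace 3 with (INR 3 * 1) by (simpl; ring); rewrite <- exp_pow.
      replace 8 with (2 ^ 3) by ring; apply pow_incr; pose proof exp1_ge2; lra. }
  apply Rle_trans with (12 * L); [|apply Rmult_le_compat_r; unfold K; lra].
  apply Rle_trans with (b * (4 * u)); [apply Rmult_le_compat_l|]; lra.
- assert (HL3 : L <= 3).
  { apply Rle_trans with (exp 1); [|apply exp_le_3].
    rewrite <- (exp_ln L) by lra; apply exp_le_compat; fold u; lra. }
  assert (Hm2 : m <= 24 / (k0 * k0)).
  { unfold m; eapply Rle_trans; [apply ln_le_sub1; lra|].
    apply Rle_trans with (8 * L / (u * u)); [lra|].
    apply Rmult_le_compat; [lra|left; apply Rinv_0_lt_compat; nra|lra|].
    apply Rinv_le_contravar; nra. }
  apply Rle_trans with (3 / k0 * L * (24 / (k0 * k0))).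
  + apply Rmult_le_compat; lra.
  + replace (3 / k0 * L * (24 / (k0 * k0))) with (72 / k0 ^ 3 * L) by (field; lra).
    apply Rmult_le_compat_r; unfold K; lra.
Qed.

Lemma regime3_upper : E <= (8 * K + 2) * b.
Proof.
destruct regime3_facts as [Hb [Hl [Hbl [HbL [Hbm Hm]]]]]; pose proof L_gt0.
assert (K1 : 0 < 72 / k0 ^ 3) by (apply Rdiv_lt_0_compat; [lra|apply pow_lt; lra]).
assert (K2 : 0 < 3 / k0) by (apply Rdiv_lt_0_compat; lra).
assert (HK : 12 <= K) by (unfold K; lra).
pose proof e_01; pose proof N_ge2.
(* The term [J * J * l / 2 >= 32 * K ^ 2 * L] beats [2 * J * m <= 18 * K ^ 2 * L] together with
   [L]. *)
destruct (nat_floor (8 * K * b)) as [j Hj]; [nra|].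
pose proof (upA (S j)) as U.
assert (El : q = exp (- l)).
{ unfold l, Rdiv; rewrite Rmult_1_l, ln_Rinv, Ropp_involutive, exp_ln; lra. }
assert (Em : 1 - q = exp (- m)).
{ unfold m, Rdiv; rewrite Rmult_1_l, ln_Rinv, Ropp_involutive, exp_ln; unfold e in *; lra. }
pose proof (geo_phi_exp q (S j) l m El Em ltac:(lra)) as PE.
rewrite S_INR in *; set (J := INR j + 1) in *.
assert (HJ : 8 * K * b <= J <= 9 * K * b).
{ assert (1 * 1 <= K * b) by (apply Rmult_le_compat; lra).
  unfold J in *; lra. }
assert (T1 : J * m <= 9 * K * (K * L)).
{ apply Rle_trans with (9 * K * b * m); [apply Rmult_le_compat_r; lra|].
  rewrite Rmult_assoc; apply Rmult_le_compat_l; lra. }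
assert (T2 : 64 * (K * K) * L <= J * J * l).
{ rewrite <- Hbl.
  assert (0 <= K * b) by (apply Rmult_le_pos; lra).
  assert (8 * K * b * (8 * K * b) <= J * J) by (apply Rmult_le_compat; lra).
  assert (8 * K * b * (8 * K * b) * l <= J * J * l) by (apply Rmult_le_compat_r; lra).
  lra. }
assert (T3 : L + (2 * J * m - J * J * l / 2) <= 0) by nra.
assert (T4 : INR n * geo_phi q (S j) 0 <= 1).
{ apply Rle_trans with (N * exp (2 * J * m - J * J * l / 2)).
  - apply Rmult_le_compat_l; [unfold N in *; lra|exact PE].
  - rewrite <- exp_L, <- exp_plus; apply exp_le1; exact T3. }
unfold J in *; nra.
Qed.

Lemma regime3_lower : 1 / (64 * K) * b <= E.
Proof.
destruct regime3_facts as [Hb [Hl [Hbl [HbL [Hbm Hm]]]]]; pose proof L_gt0.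
assert (K1 : 0 < 72 / k0 ^ 3) by (apply Rdiv_lt_0_compat; [lra|apply pow_lt; lra]).
assert (K2 : 0 < 3 / k0) by (apply Rdiv_lt_0_compat; lra).
assert (HK : 12 <= K) by (unfold K; lra).
pose proof e_01.
set (c := 1 / (16 * K)).
assert (HcK : c * K = 1 / 16) by (unfold c; field; lra).
assert (Hc0 : 0 < c) by (unfold c; apply Rdiv_lt_0_compat; lra).
assert (Hc1 : c <= 1 / 96) by nra.
replace (1 / (64 * K) * b) with (c * b / 4) by (unfold c; field; lra).
destruct (nat_floor (c * b)) as [k Hk]; [nra|].
destruct (Nat.eq_dec k 0) as [->|kn]; [simpl in Hk; lra|].
assert (Hk1 : 1 <= INR k) by (change 1 with (INR 1); apply le_INR; lia).
enough (INR k / 2 <= E) by lra.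
assert (HkL : c * b <= L / 16) by nra.
(* Single-entry windows succeed with probability exactly [exp (- (2 * k * l + m))]. The condition
   [8 <= L] holds because [1 <= k <= c * b <= L / 16]. *)
apply (lower_blocks k 1 (2 * INR k * l + m)); [lia|nra| | |].
- simpl (INR 1); pose proof (exp_ineq1_le (L / 2)); lra.
- rewrite pick_prob1.
  assert (El : q = exp (- l)).
  { unfold l, Rdiv; rewrite Rmult_1_l, ln_Rinv, Ropp_involutive, exp_ln; lra. }
  assert (Em : e = exp (- m)).
  { unfold m, Rdiv; rewrite Rmult_1_l, ln_Rinv, Ropp_involutive, exp_ln; lra. }
  right; rewrite Em, El, exp_pow, <- exp_plus, mult_INR.
  f_equal; simpl (INR 2); ring.
- assert (A1 : INR k * m <= L / 16).
  { apply Rle_trans with (c * b * m); [apply Rmult_le_compat_r; lra|]. nra. }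
  assert (A2 : INR k * INR k * l <= L / 96).
  { assert (INR k * INR k <= c * b * (c * b)) by (apply Rmult_le_compat; lra).
    assert (INR k * INR k * l <= c * b * (c * b) * l) by (apply Rmult_le_compat_r; lra).
    replace (c * b * (c * b) * l) with (c * c * (b * b * l)) in * by ring.
    rewrite Hbl in *; assert (c * c <= 1 / 96) by nra.
    assert (c * c * L <= 1 / 96 * L) by (apply Rmult_le_compat_r; lra). lra. }
  lra.
Qed.

End Regime3.

(** * The range [q <= 1 / n] *)

Lemma regime4_upper : q <= 1 / N -> E - 1 <= 4 * (N * q).
Proof.
intros Hq; pose proof N_ge2 as HN; pose proof (upA 1) as U.
assert (HqN : q * N <= 1).
{ apply Rle_trans with (1 / N * N); [apply Rmult_le_compat_r; lra|right; field; lra]. }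
assert (Hq2 : q <= 1 / 2) by nra.
simpl in U; fold N in U.
assert (q * 1 / ((1 - q) * ((1 - q) * 1)) <= 4 * q).
{ apply Rmult_le_reg_r with ((1 - q) * (1 - q)); [nra|].
  replace (q * 1 / ((1 - q) * ((1 - q) * 1)) * ((1 - q) * (1 - q))) with q
    by (field; lra).
  assert (1 <= 4 * ((1 - q) * (1 - q))) by nra. nra. }
nra.
Qed.

Lemma regime4_lower : 2 - (/ (1 + q)) ^ (n - 1) <= E -> q <= 1 / N ->
  1 / 4 * (N * q) <= E - 1.
Proof.
intros HE Hq; pose proof N_ge2 as HN.
assert (HqN : q * N <= 1).
{ apply Rle_trans with (1 / N * N); [apply Rmult_le_compat_r; lra|right; field; lra]. }
assert (E1 : INR (n - 1) = N - 1) by (rewrite minus_INR by lia; reflexivity).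
(* [poly] is Bernoulli's inequality. *)
pose proof (poly (n - 1) q (proj1 q01)) as P; rewrite E1 in P.
rewrite pow_inv in HE.
set (y := (N - 1) * q) in *.
assert (Hy : N * q / 2 <= y <= 1) by (unfold y; nra).
assert (0 < N * q) by nra.
assert (I : / (1 + q) ^ (n - 1) <= / (1 + y)) by (apply Rinv_le_contravar; lra).
assert (I2 : / (1 + y) <= 1 - y / 2).
{ apply Rmult_le_reg_r with (1 + y); [lra|]; rewrite Rinv_l by lra; nra. }
lra.
Qed.

End Regimes.

(** * Choice of the constants *)

Lemma bounds_from_inequalities :
  exists C0 c1 c C : R, 0 < C0 /\ 0 < c1 /\ 0 < c /\ c <= C /\
  forall (n : nat) (q E : R), (2 <= n)%nat -> 0 < q < 1 -> 1 <= E ->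
  (forall j, E <= INR j + INR n * geo_phi q j 0) ->
  (forall j, E <= INR j +
    INR n * ((32 / (1 - q)) ^ j / (INR (fact (2 * j)) * sqrt (1 - q)))) ->
  (forall k w, (4 * (k * w) <= n)%nat ->
    INR k * (1 - (1 - q ^ (2 * (k * w)) * (1 - q ^ w)) ^ w) <= E) ->
  (forall k w B, (0 < k)%nat -> ((B + 3) * (k * w) <= n)%nat ->
    INR k * (1 - (1 - (1 - (1 - q ^ (2 * (k * w)) * (1 - q ^ w)) ^ w) ^ k) ^ B) <= E) ->
  2 - (/ (1 + q)) ^ (n - 1) <= E ->
  let N := INR n in
  (1 - C0 / (ln N) ^ 2 <= q <= 1 - 4 / N ->
     c * (1 / sqrt (1 - q)) <= E <= C * (1 / sqrt (1 - q))) /\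
  (1 - c1 * (ln (ln N)) ^ 2 / ln N <= q <= 1 - C0 / (ln N) ^ 2 ->
     c * (ln N / ln ((1 - q) * (ln N) ^ 2)) <= E <=
     C * (ln N / ln ((1 - q) * (ln N) ^ 2))) /\
  (1 / N <= q <= 1 - c1 * (ln (ln N)) ^ 2 / ln N ->
     c * sqrt (ln N / ln (1 / q)) <= E <= C * sqrt (ln N / ln (1 / q))) /\
  (q <= 1 / N -> c * (N * q) <= E - 1 <= C * (N * q)).
Proof.
destruct lnln_away as [k0 [Hk0 Hk0n]].
set (K := 12 + 72 / k0 ^ 3 + 3 / k0).
assert (HK : 12 <= K).
{ assert (0 < 72 / k0 ^ 3) by (apply Rdiv_lt_0_compat; [lra|apply pow_lt; lra]).
  assert (0 < 3 / k0) by (apply Rdiv_lt_0_compat; lra). unfold K; lra. }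
pose proof (exp_pos (-2)); pose proof (exp_le1 (-2) ltac:(lra)).
set (c := Rmin (exp (-2) / 64) (1 / (64 * K))).
assert (Hc1 : c <= exp (-2) / 64) by apply Rmin_l.
assert (Hc2 : c <= 1 / (64 * K)) by apply Rmin_r.
assert (Hc0 : 0 < c) by (apply Rmin_glb_lt; [lra|apply Rdiv_lt_0_compat; lra]).
(* [C0 = 100] forces [Y >= 100], hence [v >= 4], in the second regime; [C] dominates the upper
   constants [102], [104], [8 * K + 2] and [4]. *)
exists 100, (1 / 8), c, (8 * K + 104).
do 4 (split; [lra|]).
intros n q E n2 q01 E1 upA upB lin blk two N.
pose proof (N_ge2 n n2) as HN; fold N in HN.
pose proof (L_gt0 n n2) as HL; fold N in HL.
assert (mono : forall x y z, x <= y -> 0 <= z -> x * z <= y * z)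
  by (intros; apply Rmult_le_compat_r; assumption).
split; [|split; [|split]].
- intros [H1 H2].
  assert (Hz : 0 <= 1 / sqrt (1 - q)).
  { left; apply Rdiv_lt_0_compat; [lra|apply sqrt_lt_R0; lra]. }
  split.
  + eapply Rle_trans; [apply mono; [exact Hc1|exact Hz]|].
    apply (regime1_lower n q E n2 q01 E1 lin); fold N; lra.
  + eapply Rle_trans; [|apply (mono 102); [lra|exact Hz]].
    apply (regime1_upper n q E n2 q01 upB); fold N; lra.
- intros [H1 H2].
  assert (HY : 100 <= (1 - q) * ln N ^ 2).
  { replace 100 with (100 / ln N ^ 2 * ln N ^ 2) by (field; lra).
    apply Rmult_le_compat_r; [apply pow_le; lra|lra]. }
  destruct (v_facts n q n2 q01 HY) as [Hv _]; fold N in Hv.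
  assert (Hz : 0 <= ln N / ln ((1 - q) * ln N ^ 2)).
  { left; apply Rdiv_lt_0_compat; lra. }
  split.
  + eapply Rle_trans; [apply (mono c (1 / 64)); [lra|exact Hz]|].
    apply (regime2_lower n q E n2 q01 E1 blk HY); fold N; lra.
  + eapply Rle_trans; [|apply (mono 104); [lra|exact Hz]].
    apply (regime2_upper n q E n2 q01 upB HY).
- intros [H1 H2].
  pose proof (sqrt_pos (ln N / ln (1 / q))) as Hz.
  assert (He : 1 / 8 * ln (ln N) ^ 2 / ln N <= 1 - q) by lra.
  split.
  + eapply Rle_trans; [apply mono; [exact Hc2|exact Hz]|].
    apply (regime3_lower n q E n2 q01 E1 blk k0 Hk0 (Hk0n n n2) He H1).
  + eapply Rle_trans; [|apply (mono (8 * K + 2)); [lra|exact Hz]].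
    apply (regime3_upper n q E n2 q01 upA k0 Hk0 (Hk0n n n2) He H1).
- intros H1.
  assert (Hz : 0 <= N * q) by (apply Rmult_le_pos; lra).
  split.
  + eapply Rle_trans; [apply (mono c (1 / 4)); [lra|exact Hz]|].
    apply (regime4_lower n q E n2 q01 two); exact H1.
  + eapply Rle_trans; [|apply (mono 4); [lra|exact Hz]].
    apply (regime4_upper n q E n2 q01 upA); exact H1.
Qed.

Require Import Defs.
From mathcomp Require Import all_boot all_order all_algebra all_fingroup.
From mathcomp Require Import Rstruct zify ring lra.
Set Implicit Arguments. Unset Strict Implicit. Unset Printing Implicit Defensive.
Import Order.TTheory GRing.Theory Num.Theory.
Local Open Scope ring_scope.

(** * Appending an entry to a permutation *)

(** The new last entry takes the value [j] and old values from [j] on move up by one. It has [n - j]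
    larger predecessors, so its [d] is [n.+1 - j]. *)
Definition ext (n : nat) (j : 'I_n.+1) (s : 'S_n) : 'S_n.+1 :=
  lift_perm ord_max j s.

Lemma ext_bij (n : nat) : bijective (fun x : 'I_n.+1 * 'S_n => ext x.1 x.2).
Proof.
apply: inj_card_bij; last first.
  by rewrite card_prod card_ord !card_Sn factS.
move=> [j s] [k t] /= e.
have ejk : j = k.
  by have := congr1 (fun u : 'S_n.+1 => u ord_max) e; rewrite /ext !lift_perm_id.
subst k; congr pair; apply/permP => i.
have := congr1 (fun u : 'S_n.+1 => u (lift ord_max i)) e.
by rewrite /ext !lift_perm_lift => /lift_inj.
Qed.

Lemma sum_ext (n : nat) (F : 'S_n.+1 -> R) :
  \sum_s F s = \sum_(s : 'S_n) \sum_j F (ext j s).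
Proof.
rewrite (reindex _ (onW_bij _ (ext_bij n))) /= exchange_big /=.
by rewrite pair_big.
Qed.

Lemma inv_count_sum (n : nat) (s : 'S_n) :
  inv_count s = (\sum_(i < n) \sum_(j < n) ((i < j)%N && (s j < s i)%N))%N.
Proof.
rewrite /inv_count -sum1dep_card big_mkcond /= pair_big /=.
by apply: eq_bigr => -[i j] _ /=; case: ifP.
Qed.

Lemma widen_ordE (n : nat) (i : 'I_n) :
  widen_ord (leqnSn n) i = lift ord_max i.
Proof. by apply: val_inj; rewrite /= /bump leqNgt ltn_ord. Qed.

Lemma sum_geq_ord (n j : nat) : (j <= n)%N -> (\sum_(v < n) (j <= v) = n - j)%N.
Proof.
elim: n => [|n IH]; first by rewrite big_ord0.
rewrite big_ord_recr /=; case: (leqP j n) => [le|lt] _; first by rewrite IH; lia.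
rewrite big1 => [|i _]; first lia.
by have := ltn_ord i; case: (leqP j i) => //; lia.
Qed.

Lemma inv_count_ext (n : nat) (j : 'I_n.+1) (s : 'S_n) :
  inv_count (ext j s) = (inv_count s + (n - j))%N.
Proof.
rewrite !inv_count_sum big_ord_recr /= [X in (_ + X)%N]big1 ?addn0; last first.
  by move=> i _; rewrite ltnNge leq_ord.
rewrite (eq_bigr (fun i : 'I_n => (\sum_(k < n) ((i < k)%N && (s k < s i)%N) +
   (j <= s i))%N)); last first.
  move=> i _; rewrite big_ord_recr /= ltn_ord /= !widen_ordE /ext.
  rewrite lift_perm_id lift_perm_lift; congr addn; last first.
    by rewrite /= /bump; case: (leqP j (s i)); lia.
  apply: eq_bigr => k _; rewrite widen_ordE lift_perm_lift /= /bump.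
  by case: (leqP j (s i)); case: (leqP j (s k)); lia.
rewrite big_split /=; congr addn.
rewrite -(sum_geq_ord (leq_ord j)).
by rewrite [RHS](reindex_inj (@perm_inj _ s)).
Qed.

Lemma sum_set_ord_recr (n : nat) (F : {set 'I_n.+1} -> R) :
  \sum_A F A = \sum_(A : {set 'I_n})
    (F (lift ord_max @: A) + F (ord_max |: (lift ord_max @: A))).
Proof.
pose h (x : {set 'I_n} * bool) : {set 'I_n.+1} :=
  if x.2 then ord_max |: (lift ord_max @: x.1) else lift ord_max @: x.1.
have nin (A : {set 'I_n}) : ord_max \notin [set lift ord_max x | x in A].
  by apply/imsetP => -[x _ /eqP]; apply/negP; exact: neq_lift.
have hb : bijective h.
  apply: inj_card_bij; last first.
    by rewrite card_prod -!cardsT -!powersetT !card_powerset !cardsT !card_ord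
               card_bool -expnSr.
  have key A b i : (lift ord_max i \in h (A, b)) = (i \in A).
    rewrite /h /=; case: b; rewrite ?in_setU1 ?(mem_imset _ _ lift_inj) //.
    by rewrite eq_sym (negbTE (neq_lift _ _)).
  move=> [A b] [B c] e; congr pair.
    by apply/setP => i; rewrite -(key A b) e key.
  move: (congr1 (fun X : {set _} => ord_max \in X) e); rewrite /h /=.
  by case: (b); case: (c); rewrite ?in_setU1 ?eqxx ?(negbTE (nin _)).
rewrite (reindex _ (onW_bij _ hb)) /=.
rewrite -(pair_big xpredT xpredT (fun A b => F (h (A, b)))) /=.
by apply: eq_bigr => A _; rewrite big_bool addrC.
Qed.

(* [level s A - 1] is the number of entries of [s] above the smallest entry
   of [s] on [A]; the empty set has level 0. *)
Definition level (n : nat) (s : 'S_n) (A : {set 'I_n}) : nat :=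
  (\max_(i in A) (n - s i))%N.

Lemma level_leq (n : nat) (s : 'S_n) (A : {set 'I_n}) : (level s A <= n)%N.
Proof. by apply/bigmax_leqP => i _; lia. Qed.

Lemma level_gt0 (n : nat) (s : 'S_n) (A : {set 'I_n}) : (0 < level s A)%N = (A != set0).
Proof.
apply/idP/idP; last first.
  case/set0Pn => i iA; apply: (leq_trans _ (leq_bigmax_cond _ iA)).
  by rewrite subn_gt0 ltn_ord.
by apply: contraTneq => ->; rewrite /level big_set0.
Qed.

Definition bump_level (d l : nat) : nat := (l + (d <= l))%N.

(** [bump_level d] is monotone, so it commutes with the maximum; [d > 0] makes it fix the level 0 of
    the empty set. *)
Lemma level_ext_old (n : nat) (j : 'I_n.+1) (s : 'S_n) (A : {set 'I_n}) :
  level (ext j s) (lift ord_max @: A) = bump_level (n.+1 - j) (level s A).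
Proof.
rewrite /level big_imset /=; last by move=> x y _ _; apply: lift_inj.
rewrite (big_morph (bump_level (n.+1 - j)) (id1 := 0%N) (op1 := maxn)); first last.
- by rewrite /bump_level; have := ltn_ord j; lia.
- by move=> x y; rewrite /bump_level; lia.
apply: eq_bigr => i _; rewrite lift_perm_lift /= /bump /bump_level.
have := ltn_ord j; have := ltn_ord (s i); case: (leqP j (s i)); lia.
Qed.

Lemma decr_onP (n : nat) (s : 'S_n) (A : {set 'I_n}) :
  reflect (forall i j, i \in A -> j \in A -> (i < j)%N -> (s j < s i)%N)
          (decr_on s A).
Proof.
apply: (iffP forall_inP) => [h i j iA jA ij|h i iA].
  by have /forall_inP /(_ j jA) /implyP := h i iA; apply.
by apply/forall_inP => j jA; apply/implyP => ij; apply: h.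
Qed.

Lemma decr_on_sub (n : nat) (s : 'S_n) (A B : {set 'I_n}) :
  A \subset B -> decr_on s B -> decr_on s A.
Proof.
move=> /subsetP AB /decr_onP h; apply/decr_onP => i j iA jA.
by apply: h; apply: AB.
Qed.

Lemma decr_on0 (n : nat) (s : 'S_n) : decr_on s set0.
Proof. by apply/decr_onP => i j; rewrite inE. Qed.

Lemma decr_on_ext_old (n : nat) (j : 'I_n.+1) (s : 'S_n) (A : {set 'I_n}) :
  decr_on (ext j s) (lift ord_max @: A) = decr_on s A.
Proof.
apply/decr_onP/decr_onP => h.
  move=> i k iA kA ik.
  have := h (lift ord_max i) (lift ord_max k) (imset_f _ iA) (imset_f _ kA).
  rewrite -!widen_ordE /= => /(_ ik); rewrite !widen_ordE !lift_perm_lift /= /bump.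
  case: (leqP j (s i)); case: (leqP j (s k)); lia.
move=> _ _ /imsetP [i iA ->] /imsetP [k kA ->]; rewrite -!widen_ordE /= => ik.
rewrite !widen_ordE !lift_perm_lift /= /bump; have := h _ _ iA kA ik.
by case: (leqP j (s i)); case: (leqP j (s k)); lia.
Qed.


(** The level condition says that all values of [s] on [A] are at least [j]; after the shift they
    exceed the new entry. *)
Lemma decr_on_ext_new (n : nat) (j : 'I_n.+1) (s : 'S_n) (A : {set 'I_n}) :
  decr_on (ext j s) (ord_max |: (lift ord_max @: A)) =
  decr_on s A && (level s A < n.+1 - j)%N.
Proof.
have lj := ltn_ord j.
rewrite -(subnSK lj) ltnS.
apply/idP/andP.
  move=> h; split.
    by rewrite -(decr_on_ext_old j); apply: decr_on_sub h; apply: subsetUr.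
  apply/bigmax_leqP => i iA.
  move/decr_onP: h => /(_ (lift ord_max i) ord_max).
  rewrite setU11 in_setU1 imset_f // orbT -widen_ordE /= ltn_ord => /(_ isT isT isT).
  rewrite widen_ordE /ext lift_perm_id lift_perm_lift /= /bump.
  by have := ltn_ord (s i); case: (leqP j (s i)); lia.
case=> dA /bigmax_leqP lv; apply/decr_onP => i k.
rewrite !in_setU1 => /orP [/eqP ->|iA] /orP [/eqP ->|kA].
- by rewrite ltnn.
- by rewrite ltnNge leq_ord.
- case/imsetP: iA => i' iA -> _.
  rewrite /ext lift_perm_id lift_perm_lift /= /bump.
  by have := lv _ iA; have := ltn_ord (s i'); case: (leqP j (s i')); lia.
- by move: i k iA kA; apply/decr_onP; rewrite decr_on_ext_old.
Qed.

Lemma level_ext_new (n : nat) (j : 'I_n.+1) (s : 'S_n) (A : {set 'I_n}) :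
  (level s A < n.+1 - j)%N ->
  level (ext j s) (ord_max |: (lift ord_max @: A)) = (n.+1 - j)%N.
Proof.
move=> lt; rewrite /level big_setU1 /=; last first.
  by apply/imsetP => -[x _ /eqP]; apply/negP; exact: neq_lift.
have -> : ext j s ord_max = j by rewrite /ext lift_perm_id.
have := level_ext_old j s A; rewrite {1}/level => ->.
by move: lt; rewrite /bump_level; lia.
Qed.

Lemma card_ext_new (n : nat) (A : {set 'I_n}) :
  #|ord_max |: (lift ord_max @: A)| = #|A|.+1.
Proof.
rewrite cardsU1 card_imset; last exact: lift_inj.
suff -> : ord_max \notin [set lift ord_max x | x in A] by [].
by apply/imsetP => -[x _ /eqP]; apply/negP; exact: neq_lift.
Qed.

Lemma card_ext_old (n : nat) (A : {set 'I_n}) : #|lift ord_max @: A| = #|A|.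
Proof. by rewrite card_imset //; apply: lift_inj. Qed.

Lemma LDS_ge (n : nat) (s : 'S_n) (A : {set 'I_n}) : decr_on s A -> (#|A| <= LDS s)%N.
Proof. exact: (@leq_bigmax_cond _ (decr_on s) (fun A => #|A|)). Qed.

Lemma LDS_witness (n : nat) (s : 'S_n) : exists2 A, decr_on s A & #|A| = LDS s.
Proof.
have ne : (0 < #|decr_on s|)%N.
  by apply/card_gt0P; exists set0; apply: decr_on0.
by have [A dA e] := @eq_bigmax_cond _ (decr_on s) (fun A => #|A|) ne; exists A.
Qed.

Lemma LDS_ext (n : nat) (j : 'I_n.+1) (s : 'S_n) : (LDS s <= LDS (ext j s))%N.
Proof.
have [A dA <-] := LDS_witness s.
by rewrite -card_ext_old; apply: LDS_ge; rewrite decr_on_ext_old.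
Qed.

Lemma bin_ge_sub (k i : nat) : (i < 'C(k.+1 + i, k.+1))%N.
Proof.
elim: i => [|i IH]; first by rewrite addn0 binn.
rewrite addnS binS; have : (0 < 'C(k.+1 + i, k))%N by rewrite bin_gt0; lia.
lia.
Qed.

(** First-moment step: a decreasing set of size [m > k] has ['C(m, k.+1) >= m - k] subsets of size
    [k.+1], all decreasing. *)
Lemma LDS_le_count (n k : nat) (s : 'S_n) :
  (LDS s <= k + #|[set A : {set 'I_n} | decr_on s A & #|A| == k.+1]|)%N.
Proof.
have [B dB <-] := LDS_witness s.
case: (leqP #|B| k) => [|lt]; first lia.
apply: leq_trans (_ : (k + 'C(#|B|, k.+1) <= _)%N).
  by have := bin_ge_sub k (#|B| - k.+1); rewrite subnKC //; lia.
rewrite leq_add2l -cards_draws; apply: subset_leq_card; apply/subsetP => A.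
by rewrite !inE => /andP [AB ->]; rewrite (decr_on_sub AB).
Qed.

(** * The level process *)

Definition qint (q : R) (n : nat) : R := \sum_(i < n) q ^+ i.

Lemma qintS q n : qint q n.+1 = qint q n + q ^+ n.
Proof. by rewrite /qint big_ord_recr. Qed.

Lemma qintE q n : (1 - q) * qint q n = 1 - q ^+ n.
Proof.
elim: n => [|n IH]; first by rewrite /qint big_ord0 mulr0 expr0 subrr.
by rewrite qintS mulrDr IH exprS; ring.
Qed.

Lemma qint_gt0 q n : 0 < q -> 0 < qint q n.+1.
Proof.
move=> q0; rewrite /qint big_ord_recl expr0 ltr_pwDl //.
by apply: sumr_ge0 => i _; rewrite exprn_ge0 // ltW.
Qed.

Lemma mallowsE n q (s : 'S_n) :
  mallows q s = q ^+ inv_count s / mallows_Z n q.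
Proof. by rewrite /mallows RdivE. Qed.

Definition ext_weight (q : R) (n : nat) (j : 'I_n.+1) : R :=
  (q ^+ (n - j) / qint q n.+1)%R.

Lemma ext_weight_ge0 q n (j : 'I_n.+1) : 0 < q -> 0 <= ext_weight q j.
Proof.
by move=> q0; rewrite /ext_weight divr_ge0 ?exprn_ge0 ?ltW ?qint_gt0.
Qed.

(** The reindexing [c = n - j] turns [d] into [c.+1], with weight proportional to [q ^+ c]. *)
Lemma sum_ext_weight q n (G : nat -> R) :
  \sum_(j < n.+1) ext_weight q j * G (n.+1 - j)%N =
  (\sum_(c < n.+1) q ^+ c * G c.+1) / qint q n.+1.
Proof.
rewrite (reindex_inj rev_ord_inj) /= mulr_suml; apply: eq_bigr => c _.
have lc : (c <= n)%N by rewrite -ltnS.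
rewrite /ext_weight /= subSS subKn // (_ : (n.+1 - (n - c) = c.+1)%N); last lia.
by rewrite mulrAC.
Qed.

Lemma sum_ext_weight1 q n : 0 < q -> \sum_(j < n.+1) ext_weight q j = 1.
Proof.
move=> q0; have := sum_ext_weight q n (fun=> 1).
rewrite (eq_bigr (fun j => ext_weight q j)) => [->|j _]; last by rewrite mulr1.
rewrite (eq_bigr (fun c : 'I_n.+1 => q ^+ c)) => [|j _]; last by rewrite mulr1.
by rewrite divff // gt_eqF // qint_gt0.
Qed.

Lemma mallows_Z_recr n q : mallows_Z n.+1 q = mallows_Z n q * qint q n.+1.
Proof.
rewrite /mallows_Z sum_ext mulr_suml; apply: eq_bigr => s _.
rewrite (eq_bigr (fun j : 'I_n.+1 => q ^+ inv_count s * q ^+ (n - j))); last first.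
  by move=> j _; rewrite inv_count_ext exprD.
rewrite -mulr_sumr; congr (_ * _); rewrite /qint (reindex_inj rev_ord_inj) /=.
by apply: eq_bigr => c _; rewrite subSS subKn // -ltnS.
Qed.

Lemma mallows_ext n q (j : 'I_n.+1) (s : 'S_n) :
  mallows q (ext j s) = mallows q s * ext_weight q j.
Proof.
by rewrite !mallowsE /ext_weight mallows_Z_recr inv_count_ext exprD invfM; ring.
Qed.

Lemma sum_mallows_ext n q (F : 'S_n.+1 -> R) :
  \sum_s mallows q s * F s =
  \sum_(s : 'S_n) mallows q s * \sum_j ext_weight q j * F (ext j s).
Proof.
rewrite sum_ext; apply: eq_bigr => s _; rewrite mulr_sumr.
by apply: eq_bigr => j _; rewrite mallows_ext mulrA.
Qed.

Lemma inv_count_S0 (s : 'S_0) : inv_count s = 0%N.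
Proof. by rewrite inv_count_sum big_ord0. Qed.

Lemma mallows_Z_gt0 n q : 0 < q -> 0 < mallows_Z n q.
Proof.
move=> q0; elim: n => [|n IH]; last by rewrite mallows_Z_recr mulr_gt0 ?qint_gt0.
rewrite /mallows_Z (eq_bigr (fun=> 1)) => [|s _]; last by rewrite inv_count_S0.
by rewrite sumr_const card_Sn.
Qed.

Lemma mallows_ge0 n q (s : 'S_n) : 0 < q -> 0 <= mallows q s.
Proof.
by move=> q0; rewrite mallowsE divr_ge0 ?exprn_ge0 ?ltW ?mallows_Z_gt0.
Qed.

Lemma sum_mallows n q : 0 < q -> \sum_(s : 'S_n) mallows q s = 1.
Proof.
move=> q0; under eq_bigr do rewrite mallowsE.
by rewrite -mulr_suml divff // gt_eqF // mallows_Z_gt0.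
Qed.

(** * Upper bound by a potential *)

Section Upper.
Variables (q : R) (phi g : nat -> nat -> R).
Hypotheses (q_gt0 : 0 < q) (q_lt1 : q < 1).
Hypotheses (phi0_ge1 : forall a, 1 <= phi 0 a)
  (phi_ge0 : forall j a, 0 <= phi j a)
  (phi_decr : forall j a, phi j a.+1 <= phi j a)
  (g_ge0 : forall j a, 0 <= g j a)
  (phi_g : forall j c, q ^+ c.+1 * phi j c.+1 <= g j c - g j c.+1)
  (g_phi : forall j a, (1 - q) * g j a <=
     (1 - q ^+ a.+1) * (phi j.+1 a - phi j.+1 a.+1)).

(** Levels of nonempty sets start at 1 while [phi] is indexed from 0; the empty set is worth
    nothing, as its contribution is accounted for separately. *)
Definition phi_level (j l : nat) : R := (if l is a.+1 then phi j a else 0)%R.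

Lemma phi_level_ge0 j l : 0 <= phi_level j l.
Proof. by case: l => [|a] /=; rewrite ?lexx. Qed.

Lemma phi_le0 j a : phi j a <= phi j 0.
Proof. by elim: a => // a IH; apply: le_trans IH. Qed.

Lemma g_le_qint j a : g j a <= qint q a.+1 * (phi j.+1 a - phi j.+1 a.+1).
Proof.
have q1 : 0 < 1 - q by rewrite subr_gt0.
by rewrite -(ler_pM2l q1) mulrA qintE.
Qed.

(** The entries [c <= a] raise the level and leave a reserve [g r a]; by [phi_g] each further jump
    is paid for by one decrement of the reserve, of which [g r (a + i)] remains. *)
Lemma drift_partial r a i :
  \sum_(c < a.+1 + i) q ^+ c * (phi_level r.+1 (bump_level c.+1 a.+1) +
     (if (a.+1 < c.+1)%N then phi_level r c.+1 else 0)) <=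
  qint q (a.+1 + i) * phi r.+1 a - g r (a + i).
Proof.
elim: i => [|i IH].
  rewrite !addn0 (eq_bigr (fun c : 'I_a.+1 => q ^+ c * phi r.+1 a.+1)); last first.
    move=> c _; rewrite /bump_level ltn_ord addn1 ltnNge ltn_ord /=.
    by rewrite addr0.
  by rewrite -mulr_suml -/(qint _ _); have := g_le_qint r a; lra.
rewrite addSn in IH; rewrite !addnS !addSn big_ord_recr /= qintS.
have -> : ((a + i).+1 < a.+1)%N = false by lia.
rewrite addn0.
have -> : (a.+1 < (a + i).+2)%N by lia.
by have := phi_g r (a + i); move: IH; rewrite /=; lra.
Qed.

(** The remaining reserve is nonnegative, so the sum may stop at any [n], and the normaliser
    [qint q n.+1] cancels. *)
Lemma drift r n l : (0 < l <= n)%N ->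
  \sum_(j < n.+1) ext_weight q j * (phi_level r.+1 (bump_level (n.+1 - j) l) +
     (if (l < n.+1 - j)%N then phi_level r (n.+1 - j) else 0)) <=
  phi_level r.+1 l.
Proof.
case: l => // a /andP [_ an].
rewrite (sum_ext_weight q n (fun d => phi_level r.+1 (bump_level d a.+1) +
     (if (a.+1 < d)%N then phi_level r d else 0))).
rewrite ler_pdivrMr ?qint_gt0 //.
have := drift_partial r a (n - a); rewrite addSn subnKC; last lia.
by move=> h; apply: (le_trans h); rewrite mulrC gerBl.
Qed.

(** The first index of [phi] is the number of entries that the set still lacks to reach size [k]. *)
Definition potential (k n : nat) (s : 'S_n) : R :=
  \sum_(A : {set 'I_n} | decr_on s A && (#|A| <= k)%N)
    phi_level (k - #|A|) (level s A).

Lemma potential_ext k n (s : 'S_n) :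
  \sum_j ext_weight q j * potential k.+1 (ext j s) <=
  potential k.+1 s + phi k 0.
Proof.
rewrite /potential [in leRHS]big_mkcond /=.
have -> : phi k 0 = \sum_(A : {set 'I_n}) if A == set0 then phi k 0 else 0.
  by rewrite -big_mkcond big_pred1_eq.
rewrite -big_split /=.
under eq_bigr => j _ do rewrite big_mkcond sum_set_ord_recr mulr_sumr.
rewrite exchange_big /=; apply: ler_sum => A _.
under eq_bigr => j _ do
  rewrite decr_on_ext_old decr_on_ext_new card_ext_old card_ext_new level_ext_old.
case dA: (decr_on s A) => /=; last first.
  rewrite big1 ?add0r => [|j _]; last by rewrite ?addr0 mulr0.
  by case: ifP.
(* The empty set is the only source of growth: it creates a singleton worth at most [phi k 0]. *)
have [A0|A0] := eqVneq A set0.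
  have lv0 : level s set0 = 0%N by rewrite /level big_set0.
  rewrite A0 cards0 lv0 /= add0r.
  rewrite -[leRHS]mul1r -(sum_ext_weight1 n q_gt0) mulr_suml; apply: ler_sum => j _.
  rewrite ler_wpM2l ?ext_weight_ge0 // /bump_level.
  have jn := ltn_ord j; have d0 : (0 < n.+1 - j)%N by rewrite subn_gt0.
  rewrite leqNgt d0 /= subSS subn0 add0r level_ext_new ?lv0 //.
  by rewrite -(subnSK jn) /=; apply: phi_le0.
have l0 : (0 < level s A <= n)%N by rewrite level_gt0 A0 level_leq.
rewrite addr0; case: (ltngtP #|A| k.+1) => [lt|gt|e].
- rewrite (subSn (m := #|A|) (n := k)) //.
  apply: le_trans (drift (k - #|A|) l0); apply: ler_sum => j _.
  rewrite ler_wpM2l ?ext_weight_ge0 // lerD2l andbT subSS.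
  by case: ifP => // h; rewrite level_ext_new.
- by rewrite big1 // => j _; rewrite andbF addr0 mulr0.
(* A complete set can only have its level raised, and [phi 0] is nonincreasing. *)
- rewrite -[leRHS]mul1r -(sum_ext_weight1 n q_gt0) mulr_suml; apply: ler_sum => j _.
  rewrite andbF addr0 ler_wpM2l ?ext_weight_ge0 // /bump_level.
  by case: (level s A) l0 => // a _; case: (leqP _ _); rewrite ?addn1 ?addn0 /= ?lexx ?phi_decr.
Qed.

Lemma mean_potential k n :
  \sum_(s : 'S_n) mallows q s * potential k.+1 s <= n%:R * phi k 0.
Proof.
elim: n => [|n IH].
  rewrite mul0r big1 // => s _; rewrite /potential big1 ?mulr0 // => A _.
  have -> : A = set0 by apply/setP => -[].
  by rewrite /level big_set0.
rewrite sum_mallows_ext.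
apply: (@le_trans _ _ (\sum_(s : 'S_n) mallows q s * (potential k.+1 s + phi k 0))).
  by apply: ler_sum => s _; rewrite ler_wpM2l ?mallows_ge0 ?potential_ext.
under eq_bigr => s _ do rewrite mulrDr.
by rewrite big_split /= -mulr_suml sum_mallows // mul1r -natr1 mulrDl mul1r lerD2r.
Qed.

Lemma E_LDS_le_potential k n : E_LDS n q <= k%:R + n%:R * phi k 0.
Proof.
apply: le_trans (lerD (lexx k%:R) (mean_potential k n)).
have -> : k%:R = \sum_(s : 'S_n) mallows q s * k%:R.
  by rewrite -mulr_suml sum_mallows // mul1r.
rewrite -big_split /=.
apply: ler_sum => s _; rewrite -mulrDr ler_wpM2l ?mallows_ge0 //.
have := LDS_le_count k s; rewrite -(ler_nat R) natrD => h; apply: (le_trans h).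
rewrite lerD2l /potential -sum1_card natr_sum big_mkcond [leRHS]big_mkcond /=.
apply: ler_sum => A _; rewrite inE; case: (decr_on s A) => //=.
case: ltngtP => // [lt|e]; first exact: phi_level_ge0.
rewrite e subnn; case lv: (level s A) => [|a] //=.
by move: (level_gt0 s A); rewrite lv -card_gt0 e.
Qed.

End Upper.

(** Conditional expectation of [LDS] after [m] more entries, given the permutation [s] built so
    far. *)
Fixpoint cond_LDS (q : R) (m t : nat) : 'S_t -> R :=
  match m with
  | 0 => fun s => ((LDS s)%:R)%R
  | m'.+1 => fun s => (\sum_(j < t.+1) ext_weight q j * cond_LDS q m' (ext j s))%R
  end.

Lemma sum_cond_LDS q m t :
  \sum_(s : 'S_t) mallows q s * cond_LDS q m s = E_LDS (m + t) q.
Proof.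
elim: m t => [|m IH] t //=.
by rewrite -(sum_mallows_ext q (fun s => cond_LDS q m s)) IH addnS.
Qed.

(** * Lower bounds by greedy windows *)

Section Lower.
Variables (q : R).
Hypotheses (q_gt0 : 0 < q) (q_lt1 : q < 1).

Let q_ge0 : 0 <= q := ltW q_gt0.
Let q_le1 : q <= 1 := ltW q_lt1.

Lemma E_LDS_ge m t x : (forall s : 'S_t, x <= cond_LDS q m s) -> x <= E_LDS (m + t) q.
Proof.
move=> h; rewrite -sum_cond_LDS -[x]mul1r -(sum_mallows t q_gt0) mulr_suml.
by apply: ler_sum => s _; rewrite ler_wpM2l ?mallows_ge0.
Qed.

Lemma cond_LDS_step_ge m t (s : 'S_t) x :
  (forall j, x <= cond_LDS q m (ext j s)) -> x <= cond_LDS q m.+1 s.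
Proof.
move=> h /=; rewrite -[x]mul1r -(sum_ext_weight1 t q_gt0) mulr_suml.
by apply: ler_sum => j _; rewrite ler_wpM2l ?ext_weight_ge0.
Qed.

Lemma cond_LDS_ge m t (s : 'S_t) : (LDS s)%:R <= cond_LDS q m s.
Proof.
elim: m t s => [|m IH] t s; first exact: lexx.
apply: cond_LDS_step_ge => j; apply: le_trans (IH _ _).
by rewrite ler_nat LDS_ext.
Qed.

Lemma cond_LDS_ge_later a m t (s : 'S_t) x :
  (forall s' : 'S_(a + t), x <= cond_LDS q m s') -> x <= cond_LDS q (a + m) s.
Proof.
elim: a t s => [|a IH] t s h; first exact: h.
by apply: cond_LDS_step_ge => j; apply: IH; rewrite addnS.
Qed.

Definition has_chain (t : nat) (s : 'S_t) (m L : nat) : Prop :=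
  exists A, [/\ decr_on s A, #|A| = m & (level s A <= L)%N].

Lemma has_chain0 t (s : 'S_t) L : has_chain s 0 L.
Proof. by exists set0; rewrite decr_on0 cards0 /level big_set0. Qed.

Lemma has_chain_LDS t (s : 'S_t) m L : has_chain s m L -> (m <= LDS s)%N.
Proof. by case=> A [dA <- _]; apply: LDS_ge. Qed.

Lemma has_chain_le t (s : 'S_t) m L L' :
  (L <= L')%N -> has_chain s m L -> has_chain s m L'.
Proof. by move=> le [A [dA cA lA]]; exists A; rewrite (leq_trans lA le). Qed.

Lemma has_chain_ext t (s : 'S_t) j m L :
  has_chain s m L -> has_chain (ext j s) m L.+1.
Proof.
case=> A [dA cA lA]; exists (lift ord_max @: A).
rewrite decr_on_ext_old card_ext_old level_ext_old /bump_level; split=> //.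
by case: leqP; lia.
Qed.

(** The exact value is [q ^+ l * (1 - q ^+ w) / (1 - q ^+ n.+1)]; [l + w <= n.+1] keeps the window
    within the range of [d]. *)
Lemma sum_window n l w : (l + w <= n.+1)%N ->
  q ^+ l * (1 - q ^+ w) <=
  \sum_(j < n.+1 | (l < n.+1 - j <= l + w)%N) ext_weight q j.
Proof.
move=> lw.
have e : \sum_(j < n.+1 | (l < n.+1 - j <= l + w)%N) ext_weight q j =
    (q ^+ l * qint q w) / qint q n.+1.
  rewrite big_mkcond /=.
  rewrite (eq_bigr (fun j : 'I_n.+1 => ext_weight q j *
    (if (l < n.+1 - j <= l + w)%N then 1 else 0))); last first.
    by move=> j _; case: ifP; rewrite ?mulr1 ?mulr0.
  rewrite (sum_ext_weight q n (fun d => if (l < d <= l + w)%N then 1 else 0)).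
  congr (_ / _).
  rewrite -(big_mkord xpredT (fun c => q ^+ c * (if (l <= c < l + w)%N then 1 else 0))).
  rewrite (big_cat_nat (n := l)) //=; last lia.
  rewrite (big_cat_nat (m := l) (n := l + w)) //=; last lia.
  rewrite big_nat big1 ?add0r; last by move=> i /andP [_ h]; rewrite leqNgt h mulr0.
  rewrite [X in _ + X]big_nat [X in _ + X]big1 ?addr0; last first.
    by move=> i /andP [h _]; rewrite ltnNge h andbF mulr0.
  rewrite -{1}[l]add0n big_addn addKn big_mkord /qint mulr_sumr.
  apply: eq_bigr => i _; rewrite leq_addl addnC ltn_add2l ltn_ord mulr1.
  by rewrite exprD.
rewrite e ler_pdivlMr ?qint_gt0 // -!qintE -mulrA ler_wpM2l ?exprn_ge0 ?q_ge0 ?q_le1 //.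
rewrite mulrAC qintE ler_piMl ?gerBl ?exprn_ge0 ?q_ge0 ?q_le1 //.
by apply: sumr_ge0 => i _; rewrite exprn_ge0 ?q_ge0 ?q_le1.
Qed.

(** The window starts at the true level [l <= L], where its probability is at least the one at [L].
    Any other entry is skipped and raises the level by at most one. *)
Lemma cond_LDS_pick m t (s : 'S_t) c L w x0 x1 :
  has_chain s c L -> (L + w <= t.+1)%N -> x0 <= x1 ->
  (forall j, has_chain (ext j s) c L.+1 -> x0 <= cond_LDS q m (ext j s)) ->
  (forall j, has_chain (ext j s) c.+1 (L + w) -> x1 <= cond_LDS q m (ext j s)) ->
  x0 + q ^+ L * (1 - q ^+ w) * (x1 - x0) <= cond_LDS q m.+1 s.
Proof.
move=> ch Lw x01 h0 h1; case: (ch) => A [dA cA lA].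
set l := level s A in lA *.
pose W := [pred j : 'I_t.+1 | (l < t.+1 - j <= l + w)%N].
have W1 j : W j -> x1 <= cond_LDS q m (ext j s).
  move=> /andP [lo hi]; apply: h1; exists (ord_max |: (lift ord_max @: A)).
  rewrite decr_on_ext_new dA lo card_ext_new cA level_ext_new //; split => //.
  by apply: leq_trans hi _; rewrite leq_add2r.
apply: (@le_trans _ _ (x0 + (\sum_(j < t.+1 | W j) ext_weight q j) * (x1 - x0))).
  rewrite lerD2l ler_wpM2r ?subr_ge0 //.
  apply: le_trans (sum_window (l := l) (w := w) (n := t) _); last lia.
  rewrite ler_wpM2r ?subr_ge0 ?exprn_ile1 ?q_ge0 ?q_le1 //.
  by rewrite ler_wiXn2l ?q_ge0 ?q_le1.
rewrite -[x0 in x0 + _]mul1r -(sum_ext_weight1 t q_gt0) !mulr_suml /=.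
rewrite [X in _ + X]big_mkcond -big_split /=; apply: ler_sum => j _.
case: ifP => [Wj|_].
  by rewrite -mulrDr addrCA subrr addr0 ler_wpM2l ?ext_weight_ge0 // W1.
by rewrite addr0 ler_wpM2l ?ext_weight_ge0 // h0 //; apply: has_chain_ext.
Qed.

Lemma cond_LDS_keep a m t (s : 'S_t) c L x : has_chain s c L ->
  (forall s' : 'S_(a + t), has_chain s' c (L + a) -> x <= cond_LDS q m s') ->
  x <= cond_LDS q (a + m) s.
Proof.
elim: a t s L => [|a IH] t s L ch h; first by apply: h; rewrite addn0.
apply: cond_LDS_step_ge => j; apply: (IH _ _ L.+1); first exact: has_chain_ext.
by rewrite addnS => s'; rewrite (addSnnS L a); apply: h.
Qed.

(* At most one element is picked among [a] consecutive entries; each entry can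
   be picked with probability at least [p], whatever happened before. *)
Lemma cond_LDS_pick_one a m t (s : 'S_t) c L w Lm x0 x1 :
  let p := q ^+ Lm * (1 - q ^+ w) in
  has_chain s c L -> (L + a <= Lm)%N -> (Lm + w <= t)%N -> x0 <= x1 ->
  (forall s' : 'S_(a + t), has_chain s' c (L + a) -> x0 <= cond_LDS q m s') ->
  (forall s' : 'S_(a + t), has_chain s' c.+1 (L + a + w) -> x1 <= cond_LDS q m s') ->
  x0 + (1 - (1 - p) ^+ a) * (x1 - x0) <= cond_LDS q (a + m) s.
Proof.
move=> p; elim: a t s L => [|a IH] t s L ch La Lt x01 h0 h1.
  by rewrite expr0 subrr mul0r addr0; apply: h0; rewrite addn0.
have La1 : (L.+1 + a <= Lm)%N by lia.
have LLm : (L <= Lm)%N by lia.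
have Lt1 : (L + w <= t.+1)%N by lia.
have Law : (L + w + a <= L + a.+1 + w)%N by lia.
have pL : p <= q ^+ L * (1 - q ^+ w).
  rewrite ler_wpM2r ?subr_ge0 ?exprn_ile1 ?q_ge0 ?q_le1 //.
  by rewrite ler_wiXn2l ?q_ge0 ?q_le1.
have w0 : 0 <= 1 - q ^+ w by rewrite subr_ge0 exprn_ile1 ?q_ge0 ?q_le1.
have p0 : 0 <= p by rewrite mulr_ge0 ?exprn_ge0 ?q_ge0 ?q_le1.
have p1 : p <= 1.
  rewrite -[1]mulr1 ler_pM ?exprn_ge0 ?exprn_ile1 ?q_ge0 ?q_le1 //.
  by rewrite gerBl exprn_ge0 ?q_ge0 ?q_le1.
have pa : 0 <= (1 - p) ^+ a <= 1.
  by rewrite exprn_ge0 ?exprn_ile1 ?subr_ge0 ?gerBl.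
set y0 := x0 + (1 - (1 - p) ^+ a) * (x1 - x0).
have y01 : y0 <= x1 by rewrite /y0; nra.
have hy0 j : has_chain (ext j s) c L.+1 -> y0 <= cond_LDS q (a + m) (ext j s).
  move=> ch'; apply: (IH _ _ L.+1) => //; first exact: leq_trans Lt _.
  - by rewrite addnS => s'; rewrite (addSnnS L a); apply: h0.
  - by rewrite addnS => s'; rewrite (addSnnS L a); apply: h1.
have hy1 j : has_chain (ext j s) c.+1 (L + w) -> x1 <= cond_LDS q (a + m) (ext j s).
  move=> ch'; apply: (cond_LDS_keep ch').
  rewrite addnS => s' /has_chain_le h; apply: h1; exact: h.
have := cond_LDS_pick ch Lt1 y01 hy0 hy1; apply: le_trans.
rewrite exprS {1}/y0.
have : 0 <= (q ^+ L * (1 - q ^+ w) - p) * (x1 - y0).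
  by rewrite mulr_ge0 ?subr_ge0.
rewrite /y0; nra.
Qed.

Definition pick_prob (k w : nat) : R :=
  (1 - (1 - q ^+ (2 * (k * w)) * (1 - q ^+ w)) ^+ w)%R.

Lemma pick_prob_01 k w : 0 <= pick_prob k w <= 1.
Proof.
have h : 0 <= q ^+ (2 * (k * w)) * (1 - q ^+ w) <= 1.
  have w0 : 0 <= q ^+ w <= 1 by rewrite exprn_ge0 ?exprn_ile1 ?q_ge0 ?q_le1.
  have k0 : 0 <= q ^+ (2 * (k * w)) <= 1 by rewrite exprn_ge0 ?exprn_ile1 ?q_ge0 ?q_le1.
  nra.
have : 0 <= (1 - q ^+ (2 * (k * w)) * (1 - q ^+ w)) ^+ w <= 1.
  by rewrite exprn_ge0 ?exprn_ile1 //; lra.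
by rewrite /pick_prob; lra.
Qed.

(** A window raises the level by at most [2 * w]: [w] from its entries and [w] from the pick. With
    [r] windows left the level is thus at most [2 * ((k - r) * w)], and it never exceeds the
    [2 * (k * w)] of [pick_prob]. *)
Lemma cond_LDS_linear k w r t (s : 'S_t) c :
  (r <= k)%N -> (2 * (k * w) + w <= t)%N ->
  has_chain s c (2 * ((k - r) * w)) ->
  c%:R + r%:R * pick_prob k w <= cond_LDS q (r * w) s.
Proof.
elim: r t s c => [|r IH] t s c rk ht ch.
  rewrite mul0r addr0; apply: le_trans (cond_LDS_ge _ _).
  by rewrite ler_nat (has_chain_LDS ch).
have e : (k - r = (k - r.+1).+1)%N by lia.
have /andP [p0 p1] := pick_prob_01 k w.
rewrite mulSn.
set x0 := c%:R + r%:R * pick_prob k w.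
have -> : c%:R + r.+1%:R * pick_prob k w =
   x0 + pick_prob k w * (x0 + 1 - x0) by rewrite /x0 -natr1; ring.
apply: (cond_LDS_pick_one (Lm := (2 * (k * w))%N) ch) => //; try nia.
- by rewrite lerDl.
- move=> s' /has_chain_le h; apply: IH; [lia|lia|].
  by apply: h; rewrite e mulSn; lia.
- move=> s' /has_chain_le h; rewrite /x0 addrAC natr1; apply: IH; [lia|lia|].
  by apply: h; rewrite e mulSn; lia.
Qed.

Lemma E_LDS_ge_linear k w n : (4 * (k * w) <= n)%N ->
  k%:R * pick_prob k w <= E_LDS n q.
Proof.
case: k => [|k] h.
  rewrite mul0r sumr_ge0 // => s _; by rewrite mulr_ge0 ?mallows_ge0 // ler0n.
(* The windows fill the last [k.+1 * w] entries; the earlier ones, at least three times as many,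
   give the room that [cond_LDS_linear] asks for. *)
have le : (k.+1 * w <= n)%N by lia.
rewrite -(subnKC le); apply: E_LDS_ge => s.
rewrite -[leLHS]add0r; apply: (cond_LDS_linear (c := 0)) => //.
  by rewrite mulSn in h *; lia.
exact: has_chain0.
Qed.

(** If all [r] remaining windows succeed, [LDS] reaches [k]; at the first failure the chain is
    abandoned and the value [x] guaranteed at the end of the block is used. *)
Lemma cond_LDS_full k w r m x t (s : 'S_t) :
  (r <= k)%N -> (2 * (k * w) + w <= t)%N -> x <= k%:R ->
  has_chain s (k - r) (2 * ((k - r) * w)) ->
  (forall s' : 'S_(r * w + t), x <= cond_LDS q m s') ->
  x + pick_prob k w ^+ r * (k%:R - x) <= cond_LDS q (r * w + m) s.
Proof.
elim: r t s => [|r IH] t s rk ht xk ch hm.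
  rewrite expr0 mul1r addrCA subrr addr0; apply: le_trans (cond_LDS_ge _ _).
  by rewrite ler_nat; have := has_chain_LDS ch; rewrite subn0.
have e : (k - r = (k - r.+1).+1)%N by lia.
have /andP [p0 p1] := pick_prob_01 k w.
have pr0 : 0 <= pick_prob k w ^+ r by rewrite exprn_ge0.
rewrite mulSn -addnA exprS.
set x1 := x + pick_prob k w ^+ r * (k%:R - x).
have -> : x + pick_prob k w * pick_prob k w ^+ r * (k%:R - x) =
   x + pick_prob k w * (x1 - x) by rewrite /x1; ring.
apply: (cond_LDS_pick_one (Lm := (2 * (k * w))%N) ch) => //; try nia.
- by rewrite /x1 lerDl mulr_ge0 // subr_ge0.
- move=> s' _; apply: cond_LDS_ge_later.
  by rewrite addnA [(_ * w + w)%N]addnC -mulSn.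
- move=> s' /has_chain_le h; apply: IH; [lia|lia|by []| |].
    by rewrite e; apply: h; rewrite mulSn; lia.
  by rewrite addnA [(_ * w + w)%N]addnC -mulSn.
Qed.

(** Each block restarts from the empty chain, and multiplies the shortfall from [k] by
    [1 - pick_prob k w ^+ k]. *)
Lemma cond_LDS_blocks k w B t (s : 'S_t) : (2 * (k * w) + w <= t)%N ->
  k%:R * (1 - (1 - pick_prob k w ^+ k) ^+ B) <= cond_LDS q (B * (k * w)) s.
Proof.
have /andP [p0 p1] := pick_prob_01 k w.
have pk : 0 <= pick_prob k w ^+ k <= 1 by rewrite exprn_ge0 ?exprn_ile1.
elim: B t s => [|B IH] t s ht.
  rewrite expr0 subrr mulr0; apply: le_trans (cond_LDS_ge _ _); exact: ler0n.
have hB : 0 <= (1 - pick_prob k w ^+ k) ^+ B by rewrite exprn_ge0 //; lra.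
have k0 : 0 <= k%:R :> R by exact: ler0n.
rewrite mulSn exprS.
set y := (1 - _) ^+ B in IH hB *.
have -> : k%:R * (1 - (1 - pick_prob k w ^+ k) * y) =
  k%:R * (1 - y) + pick_prob k w ^+ k * (k%:R - k%:R * (1 - y)) by ring.
apply: cond_LDS_full => //.
- by nra.
- by rewrite subnn; apply: has_chain0.
- by move=> s'; apply: IH; lia.
Qed.

Lemma E_LDS_ge_blocks k w B n : (0 < k)%N -> ((B + 3) * (k * w) <= n)%N ->
  k%:R * (1 - (1 - pick_prob k w ^+ k) ^+ B) <= E_LDS n q.
Proof.
case: k => // k _ h.
have le : (B * (k.+1 * w) <= n)%N by lia.
rewrite -(subnKC le); apply: E_LDS_ge => s; apply: cond_LDS_blocks.
by rewrite mulnDl mulSn in h *; lia.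
Qed.

Lemma level_singleton t (s : 'S_t.+1) : exists A, [/\ decr_on s A, #|A| = 1%N & level s A = 1%N].
Proof.
exists [set (s^-1)%g ord_max]; rewrite cards1 /level big_set1 permKV /= subSnn.
by split=> //; apply/decr_onP => i j; rewrite !inE => /eqP -> /eqP ->; rewrite ltnn.
Qed.

(** An appended entry that is not a new maximum forms a decreasing pair with the current maximum,
    the singleton of level 1. A new maximum has probability [(qint q t.+2)^-1 <= (1 + q)^-1]. *)
Lemma cond_LDS_ge2 m t (s : 'S_t.+1) : 2 - (1 + q)^-1 ^+ m <= cond_LDS q m s.
Proof.
have [A [dA cA lA]] := level_singleton s.
elim: m t s A dA cA lA => [|m IH] t s A dA cA lA.
  rewrite expr0; have := LDS_ge dA; rewrite cA -(ler_nat R) /=.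
  by lra.
have q1 : 0 < 1 + q by rewrite addr_gt0.
have r1 : 0 < (1 + q)^-1 by rewrite invr_gt0.
have rm : 0 <= (1 + q)^-1 ^+ m by rewrite exprn_ge0 // ltW.
rewrite /=.
apply: (@le_trans _ _ (\sum_(j < t.+2) ext_weight q j *
   (2 - (1 + q)^-1 ^+ m * (if (t.+2 - j == 1)%N then 1 else 0)))); last first.
  apply: ler_sum => j _; rewrite ler_wpM2l ?ext_weight_ge0 //.
  case: eqP => [ej|/eqP ej].
    rewrite mulr1; have [A' [dA' cA' lA']] := level_singleton (ext j s).
    exact: (IH _ _ A').
  rewrite mulr0 subr0; apply: le_trans (cond_LDS_ge _ _).
  rewrite (ler_nat R 2); apply: leq_trans (LDS_ge (A := ord_max |: (lift ord_max @: A)) _).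
    by rewrite card_ext_new cA.
  rewrite decr_on_ext_new dA lA /=; have := ltn_ord j; lia.
rewrite (sum_ext_weight q t.+1 (fun d => 2 - (1 + q)^-1 ^+ m * (if (d == 1)%N then 1 else 0))).
rewrite big_ord_recl /= mulr1 expr0 mul1r.
rewrite (eq_bigr (fun i : 'I_t.+1 => q ^+ i.+1 * 2)); last first.
  by move=> i _; rewrite mulr0 subr0.
rewrite -mulr_suml.
have -> : \sum_(i < t.+1) q ^+ i.+1 = qint q t.+2 - 1.
  by rewrite /qint [in RHS]big_ord_recl expr0 addrC addKr.
have Q : 1 + q <= qint q t.+2.
  rewrite /qint !big_ord_recl expr0 expr1 addrA lerDl.
  by apply: sumr_ge0 => i _; rewrite exprn_ge0 ?q_ge0 ?q_le1.
have Q0 : 0 < qint q t.+2 by apply: qint_gt0.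
rewrite ler_pdivlMr // exprS.
have : 1 <= (1 + q)^-1 * qint q t.+2.
  by rewrite mulrC ler_pdivlMr ?mul1r.
nra.
Qed.

Lemma E_LDS_ge2 n : 2 - (1 + q)^-1 ^+ n <= E_LDS n.+1 q.
Proof.
by have := @E_LDS_ge n 1 _ (fun s => cond_LDS_ge2 n s); rewrite addn1.
Qed.

End Lower.

(** * Transfer to the standard real operations and conclusion *)

Local Open Scope R_scope.

Lemma E_LDS_le_supersolution (q : R) (phi g : nat -> nat -> R) (j n : nat) :
  0 < q < 1 ->
  (forall a, 1 <= phi 0%N a) -> (forall j a, 0 <= phi j a) ->
  (forall j a, phi j a.+1 <= phi j a) -> (forall j a, 0 <= g j a) ->
  (forall j c, q ^ c.+1 * phi j c.+1 <= g j c - g j c.+1) ->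
  (forall j a, (1 - q) * g j a <= (1 - q ^ a.+1) * (phi j.+1 a - phi j.+1 a.+1)) ->
  E_LDS n q <= INR j + INR n * phi j 0%N.
Proof.
move=> [/RltP q0 /RltP q1] h1 h2 h3 h4 h5 h6; rewrite !INRE.
apply/RleP; apply: (@E_LDS_le_potential q phi g) => //.
- by move=> a; apply/RleP.
- by move=> i a; apply/RleP.
- by move=> i a; apply/RleP.
- by move=> i a; apply/RleP.
- by move=> i a; rewrite -RpowE; apply/RleP.
- by move=> i a; rewrite -RpowE; apply/RleP.
Qed.

Lemma E_LDS_le_geo (q : R) (j n : nat) :
  0 < q < 1 -> E_LDS n q <= INR j + INR n * geo_phi q j 0.
Proof.
move=> q01; apply: (E_LDS_le_supersolution (g := geo_flux q)) => //.
- by move=> a; right.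
- by move=> i a; left; apply: geo_phi_pos.
- by move=> i a; apply: geo_phi_decr.
- by move=> i a; apply: geo_flux_ge0.
- by move=> i a; apply: geo_phi_geo_flux.
- by move=> i a; apply: geo_flux_geo_phi.
Qed.

Lemma E_LDS_le_angle (q : R) (j n : nat) : 0 < q < 1 ->
  E_LDS n q <= INR j +
    INR n * ((32 / (1 - q)) ^ j / (INR (fact (2 * j)) * sqrt (1 - q))).
Proof.
move=> q01; rewrite -angle_phi_at0; apply: (E_LDS_le_supersolution (g := angle_flux q)) => //.
- by move=> a; apply: angle_phi0_ge1.
- by move=> i a; apply: angle_phi_ge0.
- by move=> i a; apply: angle_phi_decr.
- by move=> i a; apply: angle_flux_ge0.
- by move=> i a; apply: angle_phi_angle_flux.
- by move=> i a; apply: angle_flux_angle_phi.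
Qed.

Lemma pick_probE q k w :
  pick_prob q k w = 1 - (1 - q ^ (2 * (k * w)) * (1 - q ^ w)) ^ w.
Proof. by rewrite /pick_prob -!RpowE. Qed.

Lemma E_LDS_ge_linear_R (q : R) (k w n : nat) : 0 < q < 1 ->
  (4 * (k * w) <= n)%nat ->
  INR k * (1 - (1 - q ^ (2 * (k * w)) * (1 - q ^ w)) ^ w) <= E_LDS n q.
Proof.
move=> [/RltP q0 /RltP q1] h; rewrite -pick_probE INRE.
by apply/RleP; apply: E_LDS_ge_linear.
Qed.

Lemma E_LDS_ge_blocks_R (q : R) (k w B n : nat) : 0 < q < 1 ->
  (0 < k)%nat -> ((B + 3) * (k * w) <= n)%nat ->
  INR k * (1 - (1 - (1 - (1 - q ^ (2 * (k * w)) * (1 - q ^ w)) ^ w) ^ k) ^ B)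
    <= E_LDS n q.
Proof.
move=> [/RltP q0 /RltP q1] k0 h; rewrite -pick_probE INRE !RpowE.
by apply/RleP; apply: E_LDS_ge_blocks.
Qed.

Lemma E_LDS_ge2_R (q : R) (n : nat) : 0 < q < 1 ->
  2 - (/ (1 + q)) ^ n <= E_LDS n.+1 q.
Proof.
move=> [/RltP q0 /RltP q1]; rewrite RpowE.
by apply/RleP; have := E_LDS_ge2 q0 q1 n.
Qed.

Lemma E_LDS_ge1 (q : R) (n : nat) : (2 <= n)%nat -> 0 < q < 1 -> 1 <= E_LDS n q.
Proof.
case: n => // n _ q01; apply: Rle_trans (E_LDS_ge2_R n q01).
suff /(pow_unit _ n) : 0 <= / (1 + q) <= 1 by Lra.lra.
have q1 : 0 < 1 + q by Lra.lra.
split; first by left; apply: Rinv_0_lt_compat.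
by rewrite -Rinv_1; apply: Rinv_le_contravar; Lra.lra.
Qed.

Theorem theorem1p5 :
  exists C0 c1 c C : R,
    0 < C0 /\ 0 < c1 /\ 0 < c /\ c <= C /\
    forall (n : nat) (q : R),
      (2 <= n)%nat -> 0 < q < 1 ->
      let N := INR n in
      let E := E_LDS n q in
      (* (i), first regime *)
      (1 - C0 / (ln N) ^ 2 <= q <= 1 - 4 / N ->
         c * (1 / sqrt (1 - q)) <= E <= C * (1 / sqrt (1 - q))) /\
      (* (i), second regime *)
      (1 - c1 * (ln (ln N)) ^ 2 / ln N <= q <= 1 - C0 / (ln N) ^ 2 ->
         c * (ln N / ln ((1 - q) * (ln N) ^ 2)) <= E <=
         C * (ln N / ln ((1 - q) * (ln N) ^ 2))) /\
      (* (i), third regime *)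
      (1 / N <= q <= 1 - c1 * (ln (ln N)) ^ 2 / ln N ->
         c * sqrt (ln N / ln (1 / q)) <= E <= C * sqrt (ln N / ln (1 / q))) /\
      (* (ii) *)
      (q <= 1 / N -> c * (N * q) <= E - 1 <= C * (N * q)).
Proof.
have [C0 [c1 [c [C [h1 [h2 [h3 [h4 main]]]]]]]] := bounds_from_inequalities.
exists C0, c1, c, C; do 4 split=> //; move=> n q n2 q01.
have two : 2 - (/ (1 + q)) ^ (n - 1) <= E_LDS n q.
  by have := E_LDS_ge2_R n.-1 q01; rewrite prednK ?subn1 //; apply: leq_trans n2.
apply: main => //.
- exact/ssrnat.leP.
- exact: E_LDS_ge1.
- by move=> j; apply: E_LDS_le_geo.
- by move=> j; apply: E_LDS_le_angle.
- by move=> k w /ssrnat.leP; apply: E_LDS_ge_linear_R.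
- by move=> k w B /ssrnat.ltP k0 /ssrnat.leP; apply: E_LDS_ge_blocks_R.
Qed.
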